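(* Let $k$ be an algebraically closed field of characteristic $p>0$ and let $H$ be a finite-dimensional cocommutative connected Hopf algebra over $k$. Then for every $n\ge 0$, $$\Gamma^n(H)=\big(H^*/\Gamma_n(H^* )\big)^*\quad\text{and}\quad \Gamma_n(H^* )=\big(H/\Gamma^n(H)\big)^*.$$
   Context: Coradical filtration: $H_0$ is the sum of all simple subcoalgebras of $H$, $H_n=\Delta^{-1}(H\otimes H_{n-1}+H_0\otimes H)$ for $n\ge1$; $H$ is connected if $H_0$ is one-dimensional. $H^*$ is the dual Hopf algebra (commutative since $H$ is cocommutative), and $H$ is identified with $H^{**}$. Lower power series of the commutative Hopf algebra $H^*$: $\Gamma_n(H^* )=\{f^{p^n}:f\in H^*\}$. Upper power series of $H$: $\Gamma^0(H)=k$ and $\Gamma^n(H)$ is the subalgebra generated by $H_{p^{n-1}}$ for $n\ge 1$. For a normal Hopf subalgebra $K$ of a Hopf algebra $L$ (normal meaning $\sum S(l_1)kl_2\in K$ and $\sum l_1kS(l_2)\in K$ for $k\in K,l\in L$), $L/K$ denotes the quotient Hopf algebra $L/LK^+$, where $K^+=\ker\varepsilon|_K$. For a Hopf ideal $I$ of a finite-dimensional Hopf algebra $L$, $(L/I)^*$ is identified with the Hopf subalgebra $\{f\in L^*: f(I)=0\}$ of $L^*$. *)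

(* Defs.v *)
(* Finite-dimensional Hopf algebras over a field K, given in a
   fixed basis e_0 .. e_{d-1} by structure constants. *)
From HB Require Import structures.
From mathcomp Require Import all_boot all_order all_algebra.
From Stdlib Require Import ClassicalEpsilon.
Set Implicit Arguments. Unset Strict Implicit. Unset Printing Implicit Defensive.
Import GRing.Theory.
Local Open Scope ring_scope.

(* Elements of H are row vectors 'rV_d (coordinates in the basis e_i);
   elements of H (x) H are d x d matrices M, standing for sum M i j e_i (x) e_j. *)
Record hopf_data (K : fieldType) (d : nat) := HopfData {
  hmul : 'I_d -> 'I_d -> 'rV[K]_d;
  hunit : 'rV[K]_d;
  hcomul : 'I_d -> 'M[K]_(d, d);
  hcounit : 'I_d -> K;
  hanti : 'M[K]_d
}.

Section Hopf.
Variables (K : fieldType) (d : nat) (H : hopf_data K d).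

Definition evec (i : 'I_d) : 'rV[K]_d := delta_mx 0 i.
Definition tens (x y : 'rV[K]_d) : 'M[K]_(d, d) := x^T *m y.

Definition mulH (x y : 'rV[K]_d) : 'rV[K]_d :=
  \sum_(i < d) \sum_(j < d) (x 0 i * y 0 j) *: hmul H i j.
Definition comulH (x : 'rV[K]_d) : 'M[K]_(d, d) := \sum_(i < d) x 0 i *: hcomul H i.
Definition counitH (x : 'rV[K]_d) : K := \sum_(i < d) x 0 i * hcounit H i.
Definition antiH (x : 'rV[K]_d) : 'rV[K]_d := x *m hanti H.
Definition mulHH (M N : 'M[K]_(d, d)) : 'M[K]_(d, d) :=
  \sum_(i < d) \sum_(j < d) \sum_(k < d) \sum_(l < d)
     (M i j * N k l) *: tens (hmul H i k) (hmul H j l).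

Definition is_hopf : Prop :=
  [/\
      (forall x y z, mulH (mulH x y) z = mulH x (mulH y z)),
      (forall x, mulH (hunit H) x = x /\ mulH x (hunit H) = x),
      (forall x i j k, \sum_(a < d) comulH x a k * hcomul H a i j
                     = \sum_(a < d) comulH x i a * hcomul H a j k),
      (forall x, (\row_j (\sum_(i < d) hcounit H i * comulH x i j) = x) /\
                 (\row_i (\sum_(j < d) comulH x i j * hcounit H j) = x))
    & ((forall x y, comulH (mulH x y) = mulHH (comulH x) (comulH y)) /\
        comulH (hunit H) = tens (hunit H) (hunit H)) /\
      ((forall x y, counitH (mulH x y) = counitH x * counitH y) /\ counitH (hunit H) = 1) /\
      (forall x, (\sum_(i < d) \sum_(j < d) comulH x i j *: mulH (antiH (evec i)) (evec j)
                   = counitH x *: hunit H) /\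
                 (\sum_(i < d) \sum_(j < d) comulH x i j *: mulH (evec i) (antiH (evec j))
                   = counitH x *: hunit H))].

Definition cocommutative : Prop := forall x, comulH x = (comulH x)^T.

(* pairing of H^* (coordinates in the dual basis) with H *)
Definition pair (f x : 'rV[K]_d) : K := \sum_(i < d) f 0 i * x 0 i.

Definition hpow (x : 'rV[K]_d) (m : nat) : 'rV[K]_d := iter m (mulH x) (hunit H).

(* ---- subspaces of H : row spaces of square matrices (mxalgebra) ---- *)
(* tensor product U (x) V of subspaces, as a subspace of H (x) H ~ 'rV_(d*d) via mxvec *)
Definition tensS (U V : 'M[K]_d) : 'M[K]_(d * d) :=
  (\sum_(a < d) \sum_(b < d) <<mxvec (tens (row a U) (row b V))>>)%MS.

Definition subcoalg (C : 'M[K]_d) : Prop :=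
  forall x : 'rV[K]_d, (x <= C)%MS -> (mxvec (comulH x) <= tensS C C)%MS.

Definition simple_subcoalg (C : 'M[K]_d) : Prop :=
  [/\ subcoalg C, C != 0 &
      forall C', subcoalg C' -> (C' <= C)%MS -> C' = 0 \/ (C <= C')%MS].

(* the least subspace satisfying P (chosen by classical choice; it exists for the
   predicates used below) *)
Definition least (P : 'M[K]_d -> Prop) (A : 'M[K]_d) : Prop :=
  P A /\ forall B, P B -> (A <= B)%MS.
Definition lsub (P : 'M[K]_d -> Prop) : 'M[K]_d := epsilon (inhabits 0) (least P).

Definition coradical : 'M[K]_d :=
  lsub (fun W => forall C, simple_subcoalg C -> (C <= W)%MS).

Definition comul_mx : 'M[K]_(d, d * d) := \matrix_(i < d, j < d * d) (mxvec (hcomul H i)) 0 j.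
Definition preimC (W : 'M[K]_(d * d)) : 'M[K]_d := kermx (comul_mx *m cokermx W).

Fixpoint corad_filt (n : nat) : 'M[K]_d :=
  match n with
  | 0 => coradical
  | n'.+1 => preimC (tensS 1%:M (corad_filt n') + tensS coradical 1%:M)%MS
  end.

Definition connected : Prop := \rank coradical = 1%N.

Definition subalgebra (B : 'M[K]_d) : Prop :=
  (hunit H <= B)%MS /\
  forall x y, (x <= B)%MS -> (y <= B)%MS -> (mulH x y <= B)%MS.

Definition gen_subalg (V : 'M[K]_d) : 'M[K]_d :=
  lsub (fun B => subalgebra B /\ (V <= B)%MS).

Definition Gamma_up (p n : nat) : 'M[K]_d :=
  match n with
  | 0 => <<hunit H>>%MS
  | n'.+1 => gen_subalg (corad_filt (p ^ n'))
  end.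

End Hopf.

Definition dual_hopf (K : fieldType) (d : nat) (H : hopf_data K d) : hopf_data K d :=
  HopfData (fun i j => \row_k hcomul H k i j)
           (\row_k hcounit H k)
           (fun k => \matrix_(i, j) (hmul H i j) 0 k)
           (fun k => hunit H 0 k)
           (hanti H)^T.

Definition in_Gamma_low (K : fieldType) (d : nat) (H : hopf_data K d) (p n : nat)
  (g : 'rV[K]_d) : Prop :=
  exists f, g = hpow (dual_hopf H) f (p ^ n).

(* Main.v *)
Require Import Defs.
From HB Require Import structures.
From mathcomp Require Import all_boot all_order all_algebra all_field.
From mathcomp Require Import ring zify.
From Stdlib Require Import Classical ClassicalEpsilon.
Set Implicit Arguments. Unset Strict Implicit. Unset Printing Implicit Defensive.
Import GRing.Theory.
Local Open Scope ring_scope.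

(** The dual A = H^* is a commutative Hopf algebra; connectedness of H makes it
    local with nilpotent augmentation ideal m, and the n-th term of the coradical
    filtration is the annihilator of m^(n+1). Let D_j be the subalgebra of p^j-th
    powers of A, and let x_1, ..., x_r be a basis of m_j modulo m_j^2, where m_j
    is the augmentation ideal of D_j. The dual functionals, extended to A along a
    D_j-linear retraction A -> D_j, are elements h_i of the (p^j)-th term of the
    coradical filtration, and translation by h_i is a derivation of D_j. Inverting
    the matrix of derivatives of the x_l gives derivations E_i of D_j with
    E_i x_l = delta_il. The projections 1 - (x_i E_i)^(p-1) then compose to a
    D_(j+1)-linear retraction D_j -> D_(j+1), so that one can pass to the next
    level; moreover an element of D_j killed by all E_i lies in D_(j+1), and an
    ideal stable under the E_i is generated, within D_j, by its trace on D_(j+1).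
    The first fact identifies the coinvariants of Gamma^n(H) with D_n, and the
    second one, applied to the annihilator of Gamma^n(H), shows that this
    annihilator is generated by elements of D_n of augmentation 0. *)

(** * Algebras given by structure constants *)

(** [scmul k i j] is the coefficient of e_k in e_i e_j. The ring [S] is general because both
    [S = K], for A = H^*, and [S = A], for the tensor square of A, occur. *)
Record struct_const (S : comNzRingType) (d : nat) := StructConst {
  scmul : 'I_d -> 'I_d -> 'I_d -> S;
  scone : 'I_d -> S;
  scmulA : forall k i j l, \sum_a scmul k a l * scmul a i j
                         = \sum_a scmul k i a * scmul a j l;
  scmulC : forall k i j, scmul k i j = scmul k j i;
  scmul1 : forall k j, \sum_i scone i * scmul k i j = (k == j)%:R;
  scone_neq0 : exists k, scone k != 0
}.

Definition scalg (S : comNzRingType) d (c : struct_const S d) : Type := 'rV[S]_d.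
HB.instance Definition _ S d c := GRing.Lmodule.on (@scalg S d c).

Section ScAlg.
Variables (S : comNzRingType) (d : nat) (c : struct_const S d).
Local Notation A := (scalg c).

Definition sc_mul (f g : A) : A :=
  \row_k \sum_i \sum_j scmul c k i j * (f 0 i * g 0 j).
Definition sc_one : A := \row_k scone c k.

Lemma sc_mulC : commutative sc_mul.
Proof.
move=> f g; apply/rowP => k; rewrite !mxE exchange_big /=.
by do 2!apply: eq_bigr => ? _; rewrite scmulC [g _ _ * _]mulrC.
Qed.

Lemma sc_mulA : associative sc_mul.
Proof.
move=> f g h; apply/rowP => k; rewrite !mxE.
transitivity (\sum_i \sum_j \sum_l
   (\sum_a scmul c k i a * scmul c a j l) * (f 0 i * g 0 j * h 0 l)).
  apply: eq_bigr => i _.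
  under eq_bigr => a _.
    rewrite mxE !mulr_sumr.
    under eq_bigr => j _ do rewrite !mulr_sumr.
    over.
  rewrite exchange_big /=; apply: eq_bigr => j _.
  rewrite exchange_big /=; apply: eq_bigr => l _.
  by rewrite mulr_suml; apply: eq_bigr => a _; ring.
under [RHS]eq_bigr => a _.
  under eq_bigr => l _.
    rewrite mxE mulr_suml mulr_sumr.
    under eq_bigr => i _ do rewrite mulr_suml mulr_sumr.
    over.
  over.
rewrite /= [RHS]exchange_big /=.
under [RHS]eq_bigr => l _.
  rewrite exchange_big /=.
  under eq_bigr => i _ do rewrite exchange_big /=.
  over.
rewrite /= [RHS]exchange_big /=; apply: eq_bigr => i _.
rewrite [RHS]exchange_big /=; apply: eq_bigr => j _; apply: eq_bigr => l _.
by rewrite -scmulA mulr_suml; apply: eq_bigr => a _; ring.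
Qed.

Lemma sc_mul1 : left_id sc_one sc_mul.
Proof.
move=> f; apply/rowP => k; rewrite mxE exchange_big /=.
under eq_bigr => j _.
  under eq_bigr => i _ do rewrite mxE mulrA [_ * scone _ _]mulrC.
  rewrite -mulr_suml scmul1; over.
rewrite (bigD1 k) //= eqxx mul1r big1 ?addr0 // => j /negbTE jk.
by rewrite eq_sym jk mul0r.
Qed.

Lemma sc_mulDl : left_distributive sc_mul +%R.
Proof.
move=> f g h; apply/rowP => k; rewrite !mxE -big_split; apply: eq_bigr => i _.
by rewrite -big_split /=; apply: eq_bigr => j _; rewrite !mxE mulrDl mulrDr.
Qed.

Lemma sc_one_neq0 : sc_one != 0.
Proof.
have [k nz] := scone_neq0 c; apply: contraNneq nz => /rowP/(_ k).
by rewrite !mxE => ->.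
Qed.

HB.instance Definition _ :=
  GRing.Zmodule_isComNzRing.Build A sc_mulA sc_mulC sc_mul1 sc_mulDl sc_one_neq0.

Lemma sc_scaleAl (a : S) (f g : A) : a *: (f * g) = (a *: f) * g.
Proof.
apply/rowP => k; rewrite !mxE mulr_sumr; apply: eq_bigr => i _.
by rewrite mulr_sumr; apply: eq_bigr => j _; rewrite !mxE; ring.
Qed.

HB.instance Definition _ := GRing.Lmodule_isLalgebra.Build S A sc_scaleAl.
HB.instance Definition _ := GRing.Lalgebra_isComAlgebra.Build S A.

Lemma sc_mulE (f g : A) k :
  (f * g) 0 k = \sum_i \sum_j scmul c k i j * (f 0 i * g 0 j).
Proof. by rewrite mxE. Qed.

Lemma sc_oneE k : (1 : A) 0 k = scone c k.
Proof. by rewrite mxE. Qed.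

End ScAlg.

Section ScFalg.
Variables (K : fieldType) (d : nat) (c : struct_const K d).
HB.instance Definition _ := Vector.copy (scalg c) 'rV[K]_d.
HB.instance Definition _ := Algebra_isFalgebra.Build K (scalg c).
End ScFalg.

(** * Extension of scalars *)

Section BaseChange.
Variables (K : fieldType) (d : nat) (c : struct_const K d).
Variables (S : comNzRingType) (phi : {rmorphism K -> S}).

Lemma sc_map_mulA k i j l :
  \sum_a phi (scmul c k a l) * phi (scmul c a i j)
  = \sum_a phi (scmul c k i a) * phi (scmul c a j l).
Proof.
under eq_bigr do rewrite -rmorphM; under [RHS]eq_bigr do rewrite -rmorphM.
by rewrite -!rmorph_sum scmulA.
Qed.

Lemma sc_map_mulC k i j : phi (scmul c k i j) = phi (scmul c k j i).
Proof. by rewrite scmulC. Qed.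

Lemma sc_map_mul1 k j :
  \sum_i phi (scone c i) * phi (scmul c k i j) = (k == j)%:R.
Proof.
by under eq_bigr do rewrite -rmorphM; rewrite -rmorph_sum scmul1 rmorph_nat.
Qed.

Lemma sc_map_neq0 : exists k, phi (scone c k) != 0.
Proof. by have [k] := scone_neq0 c; exists k; rewrite fmorph_eq0. Qed.

Definition sc_map : struct_const S d :=
  StructConst sc_map_mulA sc_map_mulC sc_map_mul1 sc_map_neq0.

Definition sc_lift (f : scalg c) : scalg sc_map := map_mx phi f.

Lemma sc_liftX f n : sc_lift (f ^+ n) = sc_lift f ^+ n.
Proof.
elim: n => [|n IHn]; first by apply/rowP => k; rewrite mxE !sc_oneE.
rewrite !exprS -IHn; apply/rowP => k; rewrite !mxE rmorph_sum.
apply: eq_bigr => i _; rewrite rmorph_sum; apply: eq_bigr => j _.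
by rewrite !rmorphM !mxE.
Qed.

End BaseChange.

(** * The dual algebra *)

Section Pairing.
Variables (K : fieldType) (d : nat) (H : hopf_data K d).
Implicit Types f g x y : 'rV[K]_d.

Lemma pairDl f g x : pair (f + g) x = pair f x + pair g x.
Proof. by rewrite -big_split; apply: eq_bigr => i _; rewrite mxE mulrDl. Qed.

Lemma pairZl a f x : pair (a *: f) x = a * pair f x.
Proof. by rewrite mulr_sumr; apply: eq_bigr => i _; rewrite mxE mulrA. Qed.

Lemma pairC f x : pair f x = pair x f.
Proof. by apply: eq_bigr => i _; rewrite mulrC. Qed.

Lemma pairZr a f x : pair f (a *: x) = a * pair f x.
Proof. by rewrite pairC pairZl pairC. Qed.

Lemma pair0l x : pair 0 x = 0.
Proof. by rewrite -(scale0r (0 : 'rV[K]_d)) pairZl mul0r. Qed.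

Lemma pair0r f : pair f 0 = 0.
Proof. by rewrite pairC pair0l. Qed.

Lemma pairBl f g x : pair (f - g) x = pair f x - pair g x.
Proof. by rewrite -scaleN1r pairDl pairZl mulN1r. Qed.

Lemma pair_suml (I : Type) (r : seq I) (P : pred I) (F : I -> 'rV[K]_d) x :
  pair (\sum_(i <- r | P i) F i) x = \sum_(i <- r | P i) pair (F i) x.
Proof.
by apply: (big_morph (fun f => pair f x)) => [f g|]; rewrite ?pairDl ?pair0l.
Qed.

Lemma pair_sumr (I : Type) (r : seq I) (P : pred I) (F : I -> 'rV[K]_d) f :
  pair f (\sum_(i <- r | P i) F i) = \sum_(i <- r | P i) pair f (F i).
Proof. by rewrite pairC pair_suml; under eq_bigr do rewrite pairC. Qed.

Lemma pair_evecr f k : pair f (evec K k) = f 0 k.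
Proof.
rewrite /pair (bigD1 k) //= big1 => [|i /negbTE ik].
  by rewrite mxE !eqxx mulr1 addr0.
by rewrite mxE ik andbF mulr0.
Qed.

Lemma pair_evecl x k : pair (evec K k) x = x 0 k.
Proof. by rewrite pairC pair_evecr. Qed.

Lemma pair_extl f g : (forall x, pair f x = pair g x) -> f = g.
Proof. by move=> fg; apply/rowP => k; rewrite -!pair_evecr fg. Qed.

Lemma pair_extr x y : (forall f, pair f x = pair f y) -> x = y.
Proof. by move=> fg; apply/rowP => k; rewrite -!pair_evecl fg. Qed.

Lemma evec_decomp x : x = \sum_k x 0 k *: evec K k.
Proof. exact: row_sum_delta. Qed.

Lemma mulHDl x y z : mulH H (x + y) z = mulH H x z + mulH H y z.
Proof.
rewrite -big_split; apply: eq_bigr => i _; rewrite -big_split.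
by apply: eq_bigr => j _; rewrite mxE mulrDl scalerDl.
Qed.

Lemma mulHDr x y z : mulH H z (x + y) = mulH H z x + mulH H z y.
Proof.
rewrite -big_split; apply: eq_bigr => i _; rewrite -big_split.
by apply: eq_bigr => j _; rewrite mxE mulrDr scalerDl.
Qed.

Lemma mulHZl a x y : mulH H (a *: x) y = a *: mulH H x y.
Proof.
rewrite scaler_sumr; apply: eq_bigr => i _; rewrite scaler_sumr.
by apply: eq_bigr => j _; rewrite mxE scalerA mulrA.
Qed.

Lemma mulHZr a x y : mulH H x (a *: y) = a *: mulH H x y.
Proof.
rewrite scaler_sumr; apply: eq_bigr => i _; rewrite scaler_sumr.
by apply: eq_bigr => j _; rewrite mxE scalerA mulrCA.
Qed.

Lemma mulH0l x : mulH H 0 x = 0.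
Proof. by rewrite -(scale0r (0 : 'rV[K]_d)) mulHZl !scale0r. Qed.

Lemma mulH0r x : mulH H x 0 = 0.
Proof. by rewrite -(scale0r (0 : 'rV[K]_d)) mulHZr !scale0r. Qed.

Lemma mulH_suml (I : Type) (r : seq I) (P : pred I) (F : I -> 'rV[K]_d) x :
  mulH H (\sum_(i <- r | P i) F i) x = \sum_(i <- r | P i) mulH H (F i) x.
Proof.
by apply: (big_morph (fun f => mulH H f x)) => [f g|]; rewrite ?mulHDl ?mulH0l.
Qed.

Lemma mulH_sumr (I : Type) (r : seq I) (P : pred I) (F : I -> 'rV[K]_d) x :
  mulH H x (\sum_(i <- r | P i) F i) = \sum_(i <- r | P i) mulH H x (F i).
Proof.
by apply: (big_morph (fun f => mulH H x f)) => [f g|]; rewrite ?mulHDr ?mulH0r.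
Qed.

Lemma comulHE x i j : comulH H x i j = \sum_k x 0 k * hcomul H k i j.
Proof. by rewrite summxE; apply: eq_bigr => k _; rewrite mxE. Qed.

Lemma comul_evec k : comulH H (evec K k) = hcomul H k.
Proof.
apply/matrixP => i j; rewrite comulHE (bigD1 k) //= big1 => [|l /negbTE lk].
  by rewrite mxE !eqxx mul1r addr0.
by rewrite mxE lk andbF mul0r.
Qed.

Lemma mulH_evec i j : mulH H (evec K i) (evec K j) = hmul H i j.
Proof.
rewrite /mulH (bigD1 i) //= [X in _ + X]big1 => [|k /negbTE ki].
  rewrite (bigD1 j) //= big1 => [|k /negbTE kj].
    by rewrite !mxE !eqxx mulr1 scale1r !addr0.
  by rewrite !mxE kj andbF mulr0 scale0r.
by rewrite big1 // => l _; rewrite !mxE ki andbF mul0r scale0r.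
Qed.

(** The transposes of left and right multiplication by [x]. Right translations are the operators
    that later act as derivations. *)
Definition ltrans x f : 'rV[K]_d := \row_k pair f (mulH H x (evec K k)).
Definition rtrans x f : 'rV[K]_d := \row_k pair f (mulH H (evec K k) x).

Lemma pair_ltrans x f y : pair (ltrans x f) y = pair f (mulH H x y).
Proof.
rewrite [y in RHS]evec_decomp mulH_sumr pair_sumr; apply: eq_bigr => k _.
by rewrite mxE mulHZr pairZr mulrC.
Qed.

Lemma pair_rtrans x f y : pair (rtrans x f) y = pair f (mulH H y x).
Proof.
rewrite [y in RHS]evec_decomp mulH_suml pair_sumr; apply: eq_bigr => k _.
by rewrite mxE mulHZl pairZr mulrC.
Qed.

Lemma rtransD x f g : rtrans x (f + g) = rtrans x f + rtrans x g.
Proof. by apply: pair_extl => y; rewrite pairDl !pair_rtrans pairDl. Qed.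

Lemma rtransZ x a f : rtrans x (a *: f) = a *: rtrans x f.
Proof. by apply: pair_extl => y; rewrite pairZl !pair_rtrans pairZl. Qed.

(** A sum of pure tensors representing the coproduct of [f] in H^*. It is not unique, so its members
    can be chosen in a given subalgebra. *)
Definition coprod f (s : seq ('rV[K]_d * 'rV[K]_d)) :=
  forall x y, pair f (mulH H x y) = \sum_(t <- s) pair t.1 x * pair t.2 y.

Lemma coprod_ltrans f :
  coprod f [seq (evec K i, ltrans (evec K i) f) | i <- enum 'I_d].
Proof.
move=> x y; rewrite big_map big_enum /=.
rewrite [x in LHS]evec_decomp mulH_suml pair_sumr; apply: eq_bigr => k _.
by rewrite mulHZl pairZr pair_evecl pair_ltrans.
Qed.

Lemma rtrans_coprod f s x : coprod f s ->
  rtrans x f = \sum_(t <- s) pair t.2 x *: t.1.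
Proof.
move=> fs; apply: pair_extl => y; rewrite pair_rtrans fs pair_suml.
by apply: eq_bigr => t _; rewrite pairZl mulrC.
Qed.

Lemma coprod_hmul f s i k : coprod f s ->
  pair f (hmul H i k) = \sum_(t <- s) t.1 0 i * t.2 0 k.
Proof.
by move=> fs; rewrite -mulH_evec fs; under eq_bigr do rewrite !pair_evecr.
Qed.

End Pairing.

Section DualAlgebra.
Variables (K : fieldType) (d : nat) (H : hopf_data K d).
Hypotheses (hopfH : is_hopf H) (cocH : cocommutative H).

Lemma dual_mulA k i j l :
  \sum_a hcomul H k a l * hcomul H a i j = \sum_a hcomul H k i a * hcomul H a j l.
Proof.
by have [_ _ coA _ _] := hopfH; have := coA (evec K k) i j l; rewrite !comul_evec.
Qed.

Lemma dual_mulC k i j : hcomul H k i j = hcomul H k j i.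
Proof. by rewrite -!comul_evec [in LHS]cocH mxE. Qed.

Lemma dual_mul1 k j :
  \sum_i hcounit H i * hcomul H k i j = (k == j)%:R.
Proof.
have [_ _ _ /(_ (evec K k))[/rowP/(_ j)]] := hopfH.
by rewrite mxE comul_evec => -> _ _; rewrite mxE eq_sym.
Qed.

Lemma dual_one_neq0 : exists k, hcounit H k != 0.
Proof.
have [_ _ _ _ [_ [[_ /eqP u1] _]]] := hopfH.
apply: NNPP => no; case/eqP: u1; rewrite /counitH big1 ?(eq_sym 0) ?oner_eq0 //.
  by apply/eqP; rewrite eq_sym oner_eq0.
move=> i _; case: (eqVneq (hcounit H i) 0) => [->|nz]; first by rewrite mulr0.
by case: no; exists i.
Qed.

Definition dual_sc : struct_const K d :=
  StructConst dual_mulA dual_mulC dual_mul1 dual_one_neq0.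

Local Notation A := (scalg dual_sc).
Implicit Types (f g : A) (x y : 'rV[K]_d).

Lemma dual_mulE f g : mulH (dual_hopf H) f g = f * g.
Proof.
apply/rowP => k; rewrite sc_mulE summxE; apply: eq_bigr => i _.
by rewrite summxE; apply: eq_bigr => j _; rewrite !mxE mulrC.
Qed.

Lemma dual_oneE : hunit (dual_hopf H) = 1 :> A.
Proof. by apply/rowP => k; rewrite [RHS]sc_oneE /= mxE. Qed.

Lemma dual_powE f n : hpow (dual_hopf H) f n = f ^+ n.
Proof.
elim: n => [|n IHn]; first exact: dual_oneE.
by rewrite exprS -IHn -dual_mulE.
Qed.

Lemma pairM f g x :
  pair (f * g) x = \sum_i \sum_j comulH H x i j * (f 0 i * g 0 j).
Proof.
rewrite /pair; under eq_bigr => k _ do rewrite sc_mulE mulr_suml.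
rewrite exchange_big; apply: eq_bigr => i _.
under eq_bigr => k _ do rewrite mulr_suml.
rewrite exchange_big; apply: eq_bigr => j _.
rewrite comulHE mulr_suml; apply: eq_bigr => k _.
by rewrite /=; ring.
Qed.

Lemma pair1 x : pair (1 : A) x = counitH H x.
Proof. by apply: eq_bigr => k _; rewrite sc_oneE mulrC. Qed.

Lemma comulHM_entry x y a b :
  comulH H (mulH H x y) a b =
  \sum_i \sum_j \sum_k \sum_l
    comulH H x i j * comulH H y k l * (hmul H i k 0 a * hmul H j l 0 b).
Proof.
have [_ _ _ _ [[-> _] _]] := hopfH; rewrite /mulHH.
do 4!(rewrite summxE; apply: eq_bigr => ? _).
by rewrite mxE [tens _ _ _ _]mxE big_ord1 mxE.
Qed.

Lemma evecM_entry i j k : ((evec K i : A) * (evec K j : A)) 0 k = hcomul H k i j.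
Proof.
rewrite sc_mulE (bigD1 i) //= [X in _ + X]big1 => [|a /negbTE ai].
  rewrite addr0 (bigD1 j) //= big1 => [|b /negbTE bj].
    by rewrite !mxE !eqxx !mulr1 !addr0.
  by rewrite !mxE bj andbF !mulr0.
by rewrite big1 // => b _; rewrite !mxE ai andbF mul0r mulr0.
Qed.

(** Transpose of the axiom that the comultiplication of H is multiplicative. *)
Lemma coprodM f g s t : coprod H f s -> coprod H g t ->
  coprod H (f * g)
    [seq ((u.1 : A) * v.1 : 'rV_d, (u.2 : A) * v.2 : 'rV_d) | u <- s, v <- t].
Proof.
move=> fs gt x y; rewrite pairM big_allpairs_dep /=.
under eq_bigr => a _ do under eq_bigr => b _ do rewrite comulHM_entry.
(* Summing over the coordinates of [f] and [g] first turns structure constants into pairings with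
   products of basis elements. *)
transitivity (\sum_i \sum_j \sum_k \sum_l comulH H x i j * comulH H y k l *
   (pair f (hmul H i k) * pair g (hmul H j l))).
  under eq_bigr => a _.
    under eq_bigr => b _.
      rewrite mulr_suml.
      under eq_bigr => i _.
        rewrite mulr_suml.
        under eq_bigr => j _.
          rewrite mulr_suml; under eq_bigr => k _ do rewrite mulr_suml.
          over.
        over.
      over.
    rewrite exchange_big /=.
    under eq_bigr => i _.
      rewrite exchange_big /=.
      under eq_bigr => j _.
        rewrite exchange_big /=; under eq_bigr => k _ do rewrite exchange_big /=.
        over.
      over.
    over.
  rewrite exchange_big /=; apply: eq_bigr => i _.
  rewrite exchange_big /=; apply: eq_bigr => j _.
  rewrite exchange_big /=; apply: eq_bigr => k _.
  rewrite exchange_big /=; apply: eq_bigr => l _.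
  rewrite /pair mulr_suml mulr_sumr; apply: eq_bigr => a _.
  by rewrite !mulr_sumr; apply: eq_bigr => b _; ring.
transitivity (\sum_(u <- s) \sum_(v <- t) \sum_i \sum_j \sum_k \sum_l
  comulH H x i j * comulH H y k l *
   (u.1 0 i * v.1 0 j * (u.2 0 k * v.2 0 l))).
  symmetry; under eq_bigr => u _.
    rewrite exchange_big /=.
    under eq_bigr => i _.
      rewrite exchange_big /=.
      under eq_bigr => j _.
        rewrite exchange_big /=; under eq_bigr => k _ do rewrite exchange_big /=.
        over.
      over.
    over.
  rewrite exchange_big /=; apply: eq_bigr => i _.
  rewrite exchange_big /=; apply: eq_bigr => j _.
  rewrite exchange_big /=; apply: eq_bigr => k _.
  rewrite exchange_big /=; apply: eq_bigr => l _.
  rewrite (coprod_hmul _ _ fs) (coprod_hmul _ _ gt) mulr_suml mulr_sumr.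
  apply: eq_bigr => u _; rewrite !mulr_sumr; apply: eq_bigr => v _.
  by ring.
apply: eq_bigr => u _; apply: eq_bigr => v _.
rewrite !pairM mulr_suml; apply: eq_bigr => i _.
rewrite mulr_suml; apply: eq_bigr => j _.
rewrite mulr_sumr; apply: eq_bigr => k _.
by rewrite mulr_sumr; apply: eq_bigr => l _; ring.
Qed.

Local Notation T := (scalg (sc_map dual_sc (in_alg A))).

(** [T] is A with scalars extended to A, that is, the tensor square of A with the second factor as
    scalars; [comulT] is the comultiplication of H^* with values in this ring. *)
Definition comulT (f : A) : T := \row_k (ltrans H (evec K k) f : A).

Lemma comulT1 : comulT 1 = 1.
Proof.
have [_ _ _ _ [_ [[cM _] _]]] := hopfH.
apply/rowP => k; rewrite sc_oneE mxE; apply: pair_extl => y.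
by rewrite pair_ltrans pair1 cM pairZl -!pair1 pair_evecr sc_oneE.
Qed.

Lemma comulTM : {morph comulT : f g / f * g}.
Proof.
move=> f g; apply/rowP => k; rewrite sc_mulE mxE.
apply: pair_extl => y; rewrite pair_ltrans.
rewrite (coprodM (coprod_ltrans _ f) (coprod_ltrans _ g)) big_allpairs_dep /=.
rewrite big_map big_enum /= pair_suml; apply: eq_bigr => i _.
rewrite big_map big_enum /= pair_suml; apply: eq_bigr => j _.
by rewrite pair_evecr evecM_entry mulr_algl pairZl !mxE.
Qed.

Lemma comulTX f n : comulT (f ^+ n) = comulT f ^+ n.
Proof.
by elim: n => [|n IHn]; rewrite ?comulT1 // !exprS comulTM IHn.
Qed.

Lemma expr_sum_pchar (R : comNzRingType) (p n : nat) (I : Type) (r : seq I)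
    (F : I -> R) : p \in [pchar R] ->
  (\sum_(i <- r) F i) ^+ (p ^ n) = \sum_(i <- r) F i ^+ (p ^ n).
Proof.
move=> pR; have p_gt0 : (0 < p ^ n)%N.
  by rewrite expn_gt0 prime_gt0 ?(pcharf_prime pR).
apply: (big_morph (fun z => z ^+ (p ^ n))) => [a b|]; last by rewrite expr0n gtn_eqF.
by apply: exprDn_pchar; rewrite (eq_pnat _ (pcharf_eq pR)) pnatX pnat_id ?(pcharf_prime pR).
Qed.

(* Frobenius is a ring endomorphism of the tensor square of the dual, whence
   Delta(f^q) = sum_i e_i^q (x) f_i^q whenever Delta(f) = sum_i e_i (x) f_i. *)
Lemma coprodX p n f : p \in [pchar K] ->
  coprod H (f ^+ (p ^ n))
    [seq ((evec K i : A) ^+ (p ^ n) : 'rV_d,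
          (ltrans H (evec K i) f : A) ^+ (p ^ n) : 'rV_d) | i <- enum 'I_d].
Proof.
move=> pK x y; set q := (p ^ n)%N.
have pA : p \in [pchar A] by rewrite pchar_lalg.
have pT : p \in [pchar T].
  rewrite inE (pcharf_prime pA) /= -scaler_nat.
  have -> : (p%:R : A) = 0 by apply: pcharf0.
  by rewrite scale0r.
(* [e i] is the pure tensor e_i (x) 1, so [decomp] is the expansion of the coproduct along the dual
   basis. *)
pose e i : T := sc_lift (in_alg A) (evec K i : A).
have decomp g : comulT g = \sum_i (ltrans H (evec K i) g : A) *: e i.
  rewrite [LHS]row_sum_delta; apply: eq_bigr => i _; rewrite mxE.
  by congr (_ *: _); rewrite /e /sc_lift map_delta_mx.
rewrite big_map big_enum /= [x in LHS]evec_decomp mulH_suml pair_sumr.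
transitivity (\sum_k x 0 k * (pair (comulT (f ^+ q) 0 k) y)).
  by apply: eq_bigr => k _; rewrite mxE mulHZl pairZr pair_ltrans.
rewrite comulTX decomp expr_sum_pchar //.
transitivity (\sum_k x 0 k * \sum_i ((evec K i : A) ^+ q) 0 k *
   pair ((ltrans H (evec K i) f : A) ^+ q) y).
  apply: eq_bigr => k _; rewrite summxE pair_suml; congr (_ * _).
  apply: eq_bigr => i _; rewrite exprZn -sc_liftX !mxE.
  by rewrite mulr_algr pairZl.
under [LHS]eq_bigr => k _ do rewrite mulr_sumr.
rewrite [LHS]exchange_big; apply: eq_bigr => i _.
rewrite /= [X in _ = X * _]/pair mulr_suml; apply: eq_bigr => k _.
by rewrite mulrCA mulrA.
Qed.

End DualAlgebra.

(** * Derivations with dual coordinates in characteristic p *)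

Section LinearInduction.
Variables (K : fieldType) (A : falgType K).

(** Subspaces given by a proposition, so that conditions such as the vanishing of a pairing can
    serve directly as induction predicates. *)
Definition lin_closed (P : A -> Prop) :=
  P 0 /\ forall a f g, P f -> P g -> P (a *: f + g).

Lemma lin_closed_sum P (I : finType) (a : I -> K) (F : I -> A) :
  lin_closed P -> (forall i, P (F i)) -> P (\sum_i a i *: F i).
Proof.
by move=> [P0 PD] PF; elim/big_rec: _ => // i f _ Pf; apply: PD.
Qed.

Lemma lin_closed_vspace (U : {vspace A}) : lin_closed (fun f => f \in U).
Proof. by split=> [|a f g Uf Ug]; rewrite ?rpred0 ?rpredD ?rpredZ. Qed.

Lemma lin_closed_lfun (B : vectType K) (u : 'Hom(A, B)) (U : {vspace B}) :
  lin_closed (fun f => u f \in U).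
Proof.
by split=> [|a f g Uf Ug]; rewrite ?linear0 ?rpred0 // linearP rpredD ?rpredZ.
Qed.

Lemma span_ind (I : finType) (F : I -> A) P : lin_closed P ->
  (forall i, P (F i)) -> forall f, f \in <<[seq F i | i <- enum I]>>%VS -> P f.
Proof.
move=> Pc PF f; set X := [seq _ | _ <- _].
rewrite (_ : X = in_tuple X) // => /coord_span ->.
apply: lin_closed_sum => // i; have := mem_nth 0 (ltn_ord i).
by case/mapP => j _ ->.
Qed.

Lemma prodv_ind (U V : {vspace A}) P : lin_closed P ->
  (forall u v, u \in U -> v \in V -> P (u * v)) ->
  forall f, f \in (U * V)%VS -> P f.
Proof.
move=> Pc PM f; rewrite unlock; set X := allpairs _ _ _.
rewrite (_ : X = in_tuple X) // => /coord_span ->.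
apply: lin_closed_sum => // i; have := mem_nth 0 (ltn_ord i).
by case/allpairsP => t [Uu Vv ->]; apply: PM; apply: vbasis_mem.
Qed.

(** The exponent 0 is excluded because U^0 is the line spanned by 1, which need not contain U. *)
Lemma expv_antimono (U : {vspace A}) k n :
  (U * U <= U)%VS -> (0 < k <= n)%N -> (U ^+ n <= U ^+ k)%VS.
Proof.
move=> UU; elim: n => [|n IHn] /andP[k0]; first by case: k k0.
rewrite leq_eqVlt => /predU1P[<- //|kn].
apply: subv_trans (IHn _); last by rewrite k0 -ltnS.
case: n {IHn} kn => [|n _]; first by case: k k0.
by rewrite !expvSl prodvA prodvS.
Qed.

End LinearInduction.

(** * Monomials in generators of a nilpotent ideal *)

Section Monomials.
Variables (K : fieldType) (d : nat) (c : struct_const K d).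
Local Notation A := (scalg c).
Variables (m : {vspace A}) (N r : nat) (x : 'I_r -> A).
Hypotheses (m_nil : (m ^+ N = 0)%VS) (mx : forall i, x i \in m).
Hypothesis m_gen : (m <= <<[seq x i | i <- enum 'I_r]>> + m ^+ 2)%VS.
Implicit Types (f g : A) (P : A -> Prop).

(** Monomials are indexed by words, so that multiplication by a generator is [cons] and the degree
    is the length. *)
Definition mono (s : seq 'I_r) : A := \prod_(i <- s) x i.

Lemma mono_cons i s : mono (i :: s) = x i * mono s.
Proof. exact: big_cons. Qed.

Local Notation V := (<<[seq x i | i <- enum 'I_r]>>%VS).

Lemma expv_span_ind n P : lin_closed P ->
  (forall s, size s = n -> P (mono s)) -> forall f, f \in (V ^+ n)%VS -> P f.
Proof.
elim: n P => [|n IHn] P Pc Pm f.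
  rewrite expv0 => /vlineP[k ->]; rewrite -[_ *: _]addr0.
  by apply: Pc.2 Pc.1; have := Pm [::]; rewrite /mono big_nil; apply.
rewrite expvSl; apply: prodv_ind => // u v Vu Vv.
move: u Vu; apply: (@span_ind _ _ _ _ (fun u => P (u * v))) => [|i].
  split=> [|a u w Pu Pw]; first by rewrite mul0r; exact: Pc.1.
  by rewrite mulrDl -scalerAl; apply: Pc.2.
move: v Vv; apply: (IHn (fun v => P (x i * v))) => [|s ss].
  split=> [|a u w Pu Pw]; first by rewrite mulr0; exact: Pc.1.
  by rewrite mulrDr -scalerAr; apply: Pc.2.
by rewrite -mono_cons; apply: Pm; rewrite /= ss.
Qed.

Lemma span_sub : (V <= m)%VS.
Proof. by apply/span_subvP => _ /mapP[i _ ->]. Qed.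

(** The factors m are replaced by V one at a time through [m_gen]; each error term has an additional
    factor in m. *)
Lemma expv_decomp n : (m ^+ n <= V ^+ n + m ^+ n.+1)%VS.
Proof.
elim: n => [|n IHn]; first by rewrite !expv0 addvSl.
rewrite [X in (X <= _)%VS]expvSl.
apply: subv_trans (prodvS m_gen (subvv _)) _.
rewrite prodvDl subv_add -expvD addvSr andbT.
apply: subv_trans (prodvS (subvv _) IHn) _; rewrite prodvDr subv_add.
rewrite -expvSl addvSl /= [X in (_ <= _ + X)%VS]expvSl.
by apply: subv_trans (addvSr _ _); apply: prodvS => //; apply: span_sub.
Qed.

Lemma expv_nil n : (N <= n)%N -> (m ^+ n = 0)%VS.
Proof. by move/subnKC<-; rewrite expvD m_nil prod0v. Qed.

(* By nilpotency of [m], the error term of [expv_decomp] can be pushed away. *)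
Lemma mono_ind n P : lin_closed P ->
  (forall s, (n <= size s)%N -> P (mono s)) ->
  forall f, f \in (m ^+ n)%VS -> P f.
Proof.
move=> Pc; have [t] := ubnP (N - n); elim: t n => // t IHt n lt_t Pm f.
case: (leqP N n) => [/expv_nil-> | ltnN].
  by rewrite memv0 => /eqP->; exact: Pc.1.
move/(subvP (expv_decomp n)) => /memv_addP[u Vu [v mv ->]].
rewrite -[u]scale1r; apply: Pc.2.
  by apply: (expv_span_ind Pc) Vu => s ss; apply: Pm; rewrite ss.
apply: (IHt n.+1) mv => [|s ss]; last by apply: Pm; apply: ltnW.
by rewrite -ltnS (leq_trans _ lt_t) // ltnS subnS prednK // subn_gt0.
Qed.

Lemma mono_expv s (W : {vspace A}) : (forall i, x i \in W) ->
  mono s \in (W ^+ size s)%VS.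
Proof.
move=> Wx; elim: s => [|i s IHs]; first by rewrite /mono big_nil memv_line.
by rewrite mono_cons expvSl memv_mul.
Qed.

Lemma mono_count s : mono s = \prod_i x i ^+ count_mem i s.
Proof.
elim: s => [|j s IHs]; first by rewrite /mono big_nil big1.
rewrite mono_cons IHs; under [RHS]eq_bigr do rewrite /= exprD.
rewrite big_split /=; congr (_ * _).
rewrite (bigD1 j) //= eqxx expr1 big1 ?mulr1 // => i /negbTE ij.
by rewrite eq_sym ij.
Qed.

End Monomials.

(** * Euler operators and the retraction onto p-th powers *)

Section Euler.
Variables (K : fieldType) (d : nat) (c : struct_const K d) (p : nat).
Local Notation A := (scalg c).
Hypothesis pK : p \in [pchar K].
(** [D] and [m] stand for an algebra of p^j-th powers and its augmentation ideal, [D'] and [m'] for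
    the same objects at level j + 1. *)
Variables (D : {aspace A}) (m D' m' : {vspace A}) (N r : nat) (x : 'I_r -> A).
Hypotheses (D1 : 1 \in D) (mD : (m <= D)%VS) (Dm : (D <= 1 + m)%VS).
Hypotheses (m_nil : (m ^+ N = 0)%VS) (mx : forall i, x i \in m).
Hypothesis m_gen : (m <= <<[seq x i | i <- enum 'I_r]>> + m ^+ 2)%VS.
Hypothesis D'P : forall f, f \in D' <-> exists2 g, g \in D & f = g ^+ p.
Hypotheses (m'M : (m' * m' <= m')%VS) (m'x : forall i, x i ^+ p \in m').
Variable E : 'I_r -> 'End(A).
Hypothesis ED : forall i f, f \in D -> E i f \in D.
Hypothesis EM :
  forall i f g, f \in D -> g \in D -> E i (f * g) = E i f * g + f * E i g.
Hypothesis Ex : forall i j, E i (x j) = (i == j)%:R.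
Implicit Types (f g : A).

Let Dx i : x i \in D. Proof. exact: (subvP mD). Qed.

Lemma deriv1 i : E i 1 = 0.
Proof.
have := EM i D1 D1; rewrite !mulr1 mul1r => /eqP.
by rewrite -subr_eq subrr eq_sym => /eqP.
Qed.

Lemma mem_exp f n : f \in D -> f ^+ n \in D.
Proof.
by move=> Df; elim: n => [|n IHn]; rewrite ?expr0 // exprS memvM.
Qed.

Lemma mono_mem s : mono x s \in D.
Proof.
by elim: s => [|i s IHs]; rewrite ?mono_cons ?memvM // /mono big_nil.
Qed.

Lemma derivX i f n : f \in D -> E i (f ^+ n) = n%:R * f ^+ n.-1 * E i f.
Proof.
move=> Df; elim: n => [|n IHn]; first by rewrite expr0 deriv1 !mul0r.
rewrite exprS EM ?mem_exp // IHn /=; case: n {IHn} => [|n] /=.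
  by rewrite !mul0r mulr0 addr0 expr0 !mul1r mulr1.
by rewrite exprS mulrS; ring.
Qed.

Lemma pth_mem f : f \in D' -> f \in D.
Proof. by move/D'P => [g Dg ->]; apply: mem_exp. Qed.

Lemma derivXp i f : f \in D' -> E i f = 0.
Proof.
move/D'P => [g Dg ->]; rewrite derivX //.
have -> : p%:R = 0 :> A by apply: pcharf0; rewrite pchar_lalg.
by rewrite !mul0r.
Qed.

Lemma derivZp i f g : f \in D' -> g \in D -> E i (f * g) = f * E i g.
Proof.
by move=> D'f Dg; rewrite (EM i (pth_mem D'f) Dg) (derivXp i D'f) mul0r add0r.
Qed.

(** The operator x_i d/dx_i, of which every monomial is an eigenvector. *)
Definition euler i : 'End(A) := (amull (x i) \o E i)%VF.

Lemma eulerE i f : euler i f = x i * E i f.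
Proof. by rewrite comp_lfunE lfunE. Qed.

Lemma euler_mem i f : f \in D -> euler i f \in D.
Proof. by move=> Df; rewrite eulerE memvM ?ED. Qed.

Lemma euler_mono i s : euler i (mono x s) = (count_mem i s)%:R *: mono x s.
Proof.
elim: s => [|j s IHs]; first by rewrite /mono big_nil eulerE deriv1 mulr0 scale0r.
rewrite mono_cons eulerE EM ?mono_mem // Ex mulrDr [x i * (x j * _)]mulrCA.
rewrite -eulerE IHs /= natrD scalerDl -scalerAr eq_sym; congr (_ + _).
by case: eqVneq => [->|_]; rewrite /= ?mul1r ?scale1r ?mul0r ?mulr0 ?scale0r.
Qed.

Definition eulerX i n : 'End(A) := iter n (comp_lfun (euler i)) \1%VF.

Lemma eulerXS i n f : eulerX i n.+1 f = euler i (eulerX i n f).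
Proof. exact: comp_lfunE. Qed.

Lemma eulerX_mono i n s :
  eulerX i n (mono x s) = (count_mem i s)%:R ^+ n *: mono x s.
Proof.
elim: n => [|n IHn]; first by rewrite id_lfunE scale1r.
by rewrite eulerXS IHn linearZ /= euler_mono scalerA -exprSr.
Qed.

(* The Euler operator acts on monomials through the degree in x_i, taken in F_p,
   so by Fermat [1 - euler^(p-1)] is the projection onto degrees divisible by p. *)
Definition weight0 i : 'End(A) := (\1 - eulerX i p.-1)%VF.

Lemma weight0E i f : weight0 i f = f - eulerX i p.-1 f.
Proof. by rewrite add_lfunE opp_lfunE id_lfunE. Qed.

Lemma weight0_mono i s :
  weight0 i (mono x s) = if (p %| count_mem i s)%N then mono x s else 0.
Proof.
have p1 := prime_gt1 (pcharf_prime pK).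
rewrite weight0E eulerX_mono (dvdn_pcharf pK); case: eqVneq => [->|nz].
  by rewrite expr0n -subn1 subn_eq0 leqNgt p1 scale0r subr0.
suff -> : (count_mem i s)%:R ^+ p.-1 = 1 :> K by rewrite scale1r subrr.
apply: (mulfI nz); rewrite -exprS prednK ?(ltnW p1) // mulr1.
exact: (pFrobenius_aut_nat pK).
Qed.

(** The monomials may be linearly dependent, so values on them cannot be prescribed freely; a
    composite of operators is well defined on all of A. *)
Definition pretract_seq l : 'End(A) := foldr (fun i u => weight0 i \o u)%VF \1%VF l.
Definition pretract : 'End(A) := pretract_seq (enum 'I_r).

Lemma pretract_seq_cons i l f :
  pretract_seq (i :: l) f = weight0 i (pretract_seq l f).
Proof. exact: comp_lfunE. Qed.

Lemma pretract_mono s :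
  pretract (mono x s) =
  if [forall i, p %| count_mem i s]%N then mono x s else 0.
Proof.
have -> : [forall i, p %| count_mem i s]%N
        = all (fun i => p %| count_mem i s)%N (enum 'I_r).
  by apply/forallP/allP => [h i _|h i]; last apply: h; rewrite ?mem_enum.
rewrite /pretract; elim: (enum _) => [|i l IHl]; first by rewrite id_lfunE.
rewrite pretract_seq_cons IHl /= andbC; case: all => /=; last exact: linear0.
exact: weight0_mono.
Qed.

Lemma eulerX_mem i n f : f \in D -> eulerX i n f \in D.
Proof.
by move=> Df; elim: n => [|n IHn]; rewrite ?id_lfunE // eulerXS euler_mem.
Qed.

Lemma weight0_mem i f : f \in D -> weight0 i f \in D.
Proof. by move=> Df; rewrite weight0E rpredB // eulerX_mem. Qed.

Lemma eulerXZp i n f g : f \in D' -> g \in D ->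
  eulerX i n (f * g) = f * eulerX i n g.
Proof.
move=> D'f Dg; elim: n => [|n IHn]; first by rewrite !id_lfunE.
by rewrite !eulerXS IHn !eulerE derivZp ?eulerX_mem // mulrCA.
Qed.

(** Derivations of D kill p-th powers, so operators built from the [E i] are D'-linear. Membership
    in D is carried along because the product rule holds only there. *)
Lemma pretract_seq_Zp l f g : f \in D' -> g \in D ->
  pretract_seq l (f * g) = f * pretract_seq l g /\ pretract_seq l g \in D.
Proof.
move=> D'f Dg; elim: l => [|i l [IHl Dl]]; first by rewrite !id_lfunE.
rewrite !pretract_seq_cons IHl !weight0E eulerXZp // mulrBr.
by rewrite -!weight0E weight0_mem.
Qed.

Lemma pretractZp f g : f \in D' -> g \in D -> pretract (f * g) = f * pretract g.
Proof. by move=> D'f Dg; have [] := pretract_seq_Zp (enum 'I_r) D'f Dg. Qed.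

Lemma pretract1 : pretract 1 = 1.
Proof.
have := pretract_mono [::]; rewrite /mono big_nil => ->.
by case: forallP => // -[].
Qed.

Lemma mono_pth s : [forall i, p %| count_mem i s]%N ->
  exists2 t, mono x s = mono x t ^+ p & size s = (p * size t)%N.
Proof.
move/forallP => ps.
have count_flat (F : 'I_r -> nat) i :
    count_mem i (flatten [seq nseq (F j) j | j <- enum 'I_r]) = F i.
  rewrite count_flatten -map_comp sumnE big_map big_enum /= (bigD1 i) //= count_nseq /=.
  rewrite eqxx mul1n big1 ?addn0 // => j /negbTE ji.
  by rewrite count_nseq /= ji.
have size_count (u : seq 'I_r) : size u = (\sum_i count_mem i u)%N.
  elim: u => [|j u IHu]; first by rewrite big1.
  rewrite /= big_split -IHu /= (bigD1 j) //= eqxx big1 // => i /negbTE ij.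
  by rewrite eq_sym ij.
(* The p-th root divides every exponent by p; the order of the letters is irrelevant by
   [mono_count]. *)
set t := flatten [seq nseq (count_mem j s %/ p) j | j <- enum 'I_r].
exists t.
  rewrite !mono_count -prodrXl; apply: eq_bigr => i _.
  by rewrite -exprM count_flat divnK.
rewrite !size_count big_distrr; apply: eq_bigr => i _ /=.
by rewrite count_flat mulnC divnK.
Qed.

Lemma D_ind P : lin_closed P -> (forall s, P (mono x s)) ->
  forall f, f \in D -> P f.
Proof.
move=> Pc Pm f /(subvP Dm)/memv_addP[_ /vlineP[k ->] [v mv ->]]; apply: Pc.2.
  by have := Pm [::]; rewrite /mono big_nil.
by apply: (mono_ind (n := 1) m_nil mx m_gen Pc) mv => s _.
Qed.

Lemma pretract_mem f : f \in D -> pretract f \in D'.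
Proof.
move: f; apply: D_ind => [|s]; first exact: lin_closed_lfun.
rewrite pretract_mono; case: ifP => [/mono_pth[t -> _]|_]; last exact: mem0v.
by apply/D'P; exists (mono x t); rewrite ?mono_mem.
Qed.

(** A monomial of degree above p M that survives [pretract] is the p-th power of one of degree above
    M, hence a product of more than M elements [x i ^+ p] of m'. *)
Lemma pretract_expv n M f : (p * M < n)%N -> f \in (m ^+ n)%VS ->
  pretract f \in (m' ^+ M.+1)%VS.
Proof.
move=> pMn; move: f; apply: (mono_ind m_nil mx m_gen (lin_closed_lfun _ _)).
move=> s ns; rewrite pretract_mono; case: ifP => [/mono_pth[t -> st]|_].
  have Mt : (M < size t)%N.
    rewrite -(ltn_pmul2l (prime_gt0 (pcharf_prime pK))) -st.
    exact: leq_trans pMn ns.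
  rewrite /mono -prodrXl; apply: (subvP (expv_antimono m'M (_ : 0 < M.+1 <= size t)%N)) => //.
  exact: (@mono_expv _ _ _ _ (fun i => x i ^+ p)).
exact: mem0v.
Qed.

Lemma predp_gt0 : (0 < p.-1)%N.
Proof. by rewrite -subn1 subn_gt0 prime_gt1 ?(pcharf_prime pK). Qed.

Lemma eulerX_ker i n f : (0 < n)%N -> E i f = 0 -> eulerX i n f = 0.
Proof.
case: n => // n _ Ef; elim: n => [|n IHn]; last by rewrite eulerXS IHn linear0.
by rewrite eulerXS id_lfunE eulerE Ef mulr0.
Qed.

(** Since p - 1 > 0, the Euler powers kill f, so every [weight0 i] fixes f, and so does [pretract],
    whose values on D lie in D'. *)
Lemma deriv_ker f : f \in D -> (forall i, E i f = 0) -> f \in D'.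
Proof.
move=> Df Ef; suff {1}<- : pretract f = f by apply: pretract_mem.
rewrite /pretract; elim: (enum _) => [|i l IHl]; first by rewrite id_lfunE.
by rewrite pretract_seq_cons IHl weight0E eulerX_ker ?predp_gt0 ?subr0.
Qed.

Local Notation V := (<<[seq x i | i <- enum 'I_r]>>%VS).

(** Polynomials of degree less than n in the x_i. Starting from the zero space lets [E i] lower the
    index even on constants. *)
Fixpoint polys n : {vspace A} :=
  if n is n'.+1 then (1 + V * polys n')%VS else 0%VS.

Lemma polysS n : (polys n <= polys n.+1)%VS.
Proof. by elim: n => [|n IHn]; rewrite ?sub0v // addvS ?prodvS. Qed.

Lemma xV i : x i \in V.
Proof. by rewrite memv_span // map_f ?mem_enum. Qed.

Lemma polys_sub n : (polys n <= D)%VS.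
Proof.
elim: n => [|n IHn]; first exact: sub0v.
rewrite subv_add -memvE D1 prodv_sub //.
by apply: subv_trans mD; apply: span_sub.
Qed.

Lemma polys_mulx n i f : f \in polys n -> x i * f \in polys n.+1.
Proof. by move=> Pf; rewrite -[_ * _]add0r memv_add ?mem0v // memv_mul ?xV. Qed.

Lemma polys_ind n P : lin_closed P -> P 1 ->
  (forall i f, f \in polys n -> P (x i * f)) -> forall f, f \in polys n.+1 -> P f.
Proof.
move=> Pc P1 Px f /memv_addP[_ /vlineP[k ->] [v + ->]]; move=> Vv; apply: Pc.2 => //.
move: v Vv; apply: prodv_ind => // u v Vu Pv.
move: u Vu; apply: (@span_ind _ _ _ _ (fun u => P (u * v))) => [|i]; last exact: Px.
split=> [|a u w Pu Pw]; first by rewrite mul0r; exact: Pc.1.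
by rewrite mulrDl -scalerAl; apply: Pc.2.
Qed.

Lemma deriv_polys i n f : f \in polys n.+1 -> E i f \in polys n.
Proof.
elim: n f => [|n IHn]; (apply: (polys_ind (lin_closed_lfun (E i) _)); last move=> j g Pg).
- by rewrite deriv1 mem0v.
- by move: Pg; rewrite memv0 => /eqP->; rewrite mulr0 linear0 mem0v.
- by rewrite deriv1 mem0v.
- rewrite (EM i (Dx j) (subvP (polys_sub _) _ Pg)) Ex rpredD ?polys_mulx ?IHn //.
  by case: eqP; rewrite ?mul1r ?mul0r ?mem0v.
Qed.

Lemma euler_polys i n f : f \in polys n -> euler i f \in polys n.
Proof.
case: n => [|n] Pf; first by move: Pf; rewrite !memv0 => /eqP->; rewrite linear0.
by rewrite eulerE polys_mulx ?deriv_polys.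
Qed.

Lemma eulerX_polys i k n f : f \in polys n -> eulerX i k f \in polys n.
Proof.
by move=> Pf; elim: k => [|k IHk]; rewrite ?id_lfunE // eulerXS euler_polys.
Qed.

Lemma mono_polys s : mono x s \in polys (size s).+1.
Proof.
elim: s => [|i s IHs]; last by rewrite mono_cons polys_mulx.
by rewrite /mono big_nil -[1]addr0 memv_add ?memv_line ?mem0v.
Qed.

Lemma polys_leq k n : (k <= n)%N -> (polys k <= polys n)%VS.
Proof.
by move/subnKC<-; elim: (n - k)%N => [|t IHt]; rewrite ?addn0 // addnS
  (subv_trans IHt) // polysS.
Qed.

Lemma D_polys f : f \in D -> f \in polys N.+1.
Proof.
move: f; apply: D_ind => [|s]; first exact: lin_closed_vspace.
(* Monomials with more than N factors vanish because m^N = 0. *)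
case: (leqP (size s) N) => [sN|Ns].
  by apply: (subvP (polys_leq _)) (mono_polys s); rewrite ltnS.
have := mono_expv s mx; rewrite (expv_nil m_nil (ltnW Ns)) memv0 => /eqP->.
exact: mem0v.
Qed.

(* Induction on the degree: [f - weight0 i f] is [x i * E i g] with [g] in J of
   the same degree as [f], and [E i] lowers the degree. *)
Lemma stable_ideal_descent (J I : A -> Prop) :
  (forall f g, J f -> J g -> J (f - g)) ->
  (forall f g, J f -> J (g * f)) ->
  (forall i f, J f -> J (E i f)) ->
  (forall f g, I f -> I g -> I (f + g)) ->
  (forall f g, I f -> I (g * f)) ->
  (forall f, f \in D' -> J f -> I f) ->
  forall f, f \in D -> J f -> I f.
Proof.
move=> JB JM JE ID IM JI f Df.
have := D_polys Df; move: N.+1 => n; elim: n f Df => [|n IHn] f Df.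
  by rewrite memv0 => /eqP->; apply: JI; exact: mem0v.
move=> Pf Jf.
have Jeul i k g : J g -> J (eulerX i k g).
  by move=> Jg; elim: k => [|k IHk]; rewrite ?id_lfunE // eulerXS eulerE; auto.
(* The last component leads back from a partial composite to [f]; for the full list the composite
   lies in D', where [JI] applies. *)
suff H l : [/\ J (pretract_seq l f), pretract_seq l f \in polys n.+1,
    pretract_seq l f \in D & I (pretract_seq l f) -> I f].
  have [Jg _ _] := H (enum 'I_r); apply; apply: JI => //.
  exact: pretract_mem.
elim: l => [|i l [Jg Pg Dg Ig]]; first by rewrite id_lfunE.
rewrite pretract_seq_cons; set g := pretract_seq l f in Jg Pg Dg Ig *.
split.
- by rewrite weight0E; apply: JB; auto.
- by rewrite weight0E rpredB // eulerX_polys.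
- exact: weight0_mem.
move=> Iw; apply: Ig; rewrite -[g](subrK (weight0 i g)) addrC; apply: ID => //.
rewrite weight0E opprB addrC subrK.
have -> : p.-1 = p.-2.+1 by rewrite prednK // predp_gt0.
rewrite eulerXS eulerE; apply: IM; apply: IHn.
- by rewrite ED ?eulerX_mem.
- by rewrite deriv_polys ?eulerX_polys.
- by apply: JE; apply: Jeul.
Qed.

End Euler.

(** * The tower of Frobenius subalgebras *)

Section Augmentation.
Variables (K : fieldType) (d : nat) (H : hopf_data K d).
Hypotheses (hopfH : is_hopf H) (cocH : cocommutative H).
Local Notation A := (scalg (dual_sc hopfH cocH)).
Implicit Types (f g : A) (x y h : 'rV[K]_d).

Definition evalA x (f : A) : K^o := pair f x.

Lemma evalA_linear x : linear (evalA x).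
Proof. by move=> a f g; rewrite /evalA pairDl pairZl. Qed.
HB.instance Definition _ x := GRing.isLinear.Build K A K^o _ _ (evalA_linear x).

Definition annv x : {vspace A} := lker (linfun (evalA x)).

Lemma mem_annv x f : (f \in annv x) = (pair f x == 0).
Proof. by rewrite memv_ker lfunE. Qed.

Definition dual_eps : A -> K^o := evalA (hunit H).
HB.instance Definition _ := GRing.Linear.on dual_eps.

Lemma dual_eps_mult : monoid_morphism dual_eps.
Proof.
have [_ _ _ _ [[_ cu] [[_ c1] _]]] := hopfH.
split=> [|f g]; first by rewrite /dual_eps /evalA pair1 c1.
rewrite /dual_eps /evalA pairM cu mulr_suml; apply: eq_bigr => i _.
rewrite mulr_sumr; apply: eq_bigr => j _.
by rewrite mxE big_ord1 mxE; ring.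
Qed.
HB.instance Definition _ := GRing.isMonoidMorphism.Build A K^o dual_eps dual_eps_mult.

Definition rtransA h (f : A) : A := rtrans H h f.

Lemma rtransA_linear h : linear (rtransA h).
Proof. by move=> a f g; rewrite /rtransA rtransD rtransZ. Qed.
HB.instance Definition _ h := GRing.isLinear.Build K A A _ _ (rtransA_linear h).

(** The identification of H with H^{**}; it turns the functionals dual to generators into elements
    of H. *)
Lemma functional_repr (phi : {linear A -> K^o}) : exists h, forall f, pair f h = phi f.
Proof.
exists (\row_k phi (evec K k)) => f.
rewrite [f in RHS]evec_decomp linear_sum; apply: eq_bigr => k _.
by rewrite linearZ mxE.
Qed.

Definition aug : {vspace A} := annv (hunit H).

Lemma mem_aug f : (f \in aug) = (dual_eps f == 0).
Proof. exact: mem_annv. Qed.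

Lemma aug_sub f : f - (dual_eps f)%:A \in aug.
Proof. by rewrite mem_aug rmorphB /= linearZ /= rmorph1 [_ *: _]mulr1 subrr. Qed.

Lemma aug_mul f g : f \in aug -> g * f \in aug.
Proof. by rewrite !mem_aug rmorphM /= => /eqP->; rewrite mulr0. Qed.

Lemma rtrans_unit f : rtransA (hunit H) f = f.
Proof.
have [_ u1 _ _ _] := hopfH.
by apply: pair_extl => y; rewrite pair_rtrans (u1 y).2.
Qed.

Lemma eps_rtrans h f : dual_eps (rtransA h f) = pair f h.
Proof.
have [_ u1 _ _ _] := hopfH.
by rewrite /dual_eps /evalA pair_rtrans (u1 h).1.
Qed.

Lemma rtransA_coprod f s h : coprod H f s ->
  rtransA h f = \sum_(t <- s) pair t.2 h *: (t.1 : A).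
Proof. exact: rtrans_coprod. Qed.

End Augmentation.

Section AspaceMatrices.
Variables (K : fieldType) (d : nat) (c : struct_const K d).
Variable D : {aspace scalg c}.
Hypothesis D1 : 1 \in D.

Lemma aspace_det n (M : 'M[scalg c]_n) : (forall i j, M i j \in D) -> \det M \in D.
Proof.
move=> DM; apply: rpred_sum => s _; apply: memvM.
  by case: (perm.odd_perm s); rewrite ?expr0 // expr1 rpredN.
by apply: (big_ind (fun f => f \in D)) => // f g Df Dg; apply: memvM.
Qed.

Lemma aspace_invmx n (M : 'M[scalg c]_n) : (forall i j, M i j \in D) ->
  forall i j, invmx M i j \in D.
Proof.
(* [invmx] returns a singular matrix unchanged; otherwise its entries are cofactors times the
   inverse of the determinant, which stays in D. *)
move=> DM i j; rewrite /invmx; case: ifP => _ //; rewrite !mxE.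
apply: memvM; first by rewrite memvV aspace_det.
apply: memvM; last by apply: aspace_det => k l; rewrite !mxE.
by rewrite -signr_odd; case: odd; rewrite ?expr0 // expr1 rpredN.
Qed.

End AspaceMatrices.

(** * Algebras of p^j-th powers and the passage from level j to level j + 1 *)

Section Levels.
Variables (K : closedFieldType) (p d : nat) (H : hopf_data K d).
Hypotheses (pK : p \in [pchar K]) (hopfH : is_hopf H) (cocH : cocommutative H).
Local Notation A := (scalg (dual_sc hopfH cocH)).
Local Notation m := (aug hopfH cocH).
Local Notation eps := (@dual_eps _ _ _ hopfH cocH).
Local Notation rt := (@rtransA _ _ _ hopfH cocH).
Implicit Types (f g : A) (x y h : 'rV[K]_d).

Lemma pA : p \in [pchar A].
Proof. by rewrite pchar_lalg. Qed.

Let q_gt0 j : (0 < p ^ j)%N.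
Proof. by rewrite expn_gt0 prime_gt0 ?(pcharf_prime pK). Qed.

Definition frobv j : {vspace A} :=
  <<[seq ((evec K i : A) ^+ (p ^ j))%R | i <- enum 'I_d]>>%VS.

Lemma root_pth (a : K) n : (0 < n)%N -> exists b, b ^+ n = a.
Proof.
move=> n_gt0.
have [b Db] := @solve_monicpoly K n (fun i => if i is 0 then a else 0) n_gt0.
exists b; rewrite Db; case: n n_gt0 {Db} => // n _.
by rewrite big_ord_recl /= expr0 mulr1 big1 ?addr0 // => i _; rewrite mul0r.
Qed.

(** Algebraic closedness enters here: scalars have p^j-th roots and Frobenius is additive, so the
    p^j-th powers already form a K-subspace. *)
Lemma frobvP j f : f \in frobv j <-> exists g, f = g ^+ (p ^ j).
Proof.
split.
  move: f; apply: span_ind => [|i]; last by exists (evec K i).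
  split=> [|a _ _ [f ->] [g ->]]; first by exists 0; rewrite expr0n gtn_eqF.
  have [b <-] := root_pth a (q_gt0 j).
  exists (b *: f + g); rewrite exprDn_pchar ?exprZn //.
  by rewrite (eq_pnat _ (pcharf_eq pA)) pnatX pnat_id ?(pcharf_prime pK).
case=> g ->; rewrite [g]evec_decomp (expr_sum_pchar _ _ _ pA).
apply: rpred_sum => i _; rewrite exprZn rpredZ // memv_span //.
by apply: map_f; rewrite mem_enum.
Qed.

Lemma frobv_aspace j : is_aspace (frobv j).
Proof.
rewrite /is_aspace has_algid1; last by apply/frobvP; exists 1; rewrite expr1n.
by apply/prodvP => _ _ /frobvP[f ->] /frobvP[g ->]; apply/frobvP; exists (f * g);
  rewrite exprMn.
Qed.
Definition frobA j : {aspace A} := ASpace (frobv_aspace j).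

Lemma frob1 j : 1 \in frobA j.
Proof. by apply/frobvP; exists 1; rewrite expr1n. Qed.

Lemma frobS j f : f \in frobv j.+1 <-> exists2 g, g \in frobA j & f = g ^+ p.
Proof.
split=> [/frobvP[g ->]|[_ /frobvP[g ->] ->]].
  by exists (g ^+ (p ^ j)); [apply/frobvP; exists g | rewrite -exprM -expnSr].
by apply/frobvP; exists g; rewrite -exprM -expnSr.
Qed.

(** By [coprodX], D_j is closed under the comultiplication of H^*. *)
Lemma frob_coprod j f : f \in frobv j -> exists2 s, coprod H f s &
  forall t, t \in s -> (t.1 : A) \in frobv j /\ (t.2 : A) \in frobv j.
Proof.
case/frobvP => g ->; eexists; first exact: coprodX.
by move=> _ /mapP[i _ ->]; split; apply/frobvP; eexists.
Qed.

Lemma rtrans_frob h j f : f \in frobv j -> rt h f \in frobv j.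
Proof.
case/frob_coprod => s fs Ds; rewrite (rtransA_coprod _ fs) big_seq.
by apply: rpred_sum => t /Ds[D1 _]; apply: rpredZ.
Qed.

(** Translation by h applies h to the second tensor factors of the coproduct; these stay in D_j,
    where h is a derivation at the augmentation. *)
Lemma rtrans_deriv h j :
  (forall f g, f \in frobv j -> g \in frobv j ->
     pair (f * g) h = pair f h * eps g + eps f * pair g h) ->
  forall f g, f \in frobv j -> g \in frobv j -> rt h (f * g) = rt h f * g + f * rt h g.
Proof.
move=> der f g Df Dg.
have [s fs Ds] := frob_coprod Df; have [t gt Dt] := frob_coprod Dg.
have fgst := coprodM fs gt.
(* Writing f and g as translates by the unit lets all four factors be expanded along the same
   coproducts. *)
rewrite -[X in _ * X + _](rtrans_unit g) -[X in _ + X * _](rtrans_unit f).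
rewrite (rtransA_coprod _ fgst) !(rtransA_coprod _ fs) !(rtransA_coprod _ gt).
rewrite big_allpairs_dep /= !mulr_suml -big_split big_seq [RHS]big_seq /=.
apply: eq_bigr => u su; rewrite !mulr_sumr -big_split big_seq [RHS]big_seq /=.
apply: eq_bigr => v tv; rewrite der; [|exact: (Ds _ su).2|exact: (Dt _ tv).2].
by rewrite -!scalerAl -!scalerAr !scalerA scalerDl /dual_eps /evalA.
Qed.

Definition frobm j : {vspace A} := (frobv j :&: m)%VS.

Lemma frobm_mul j : (frobm j * frobm j <= frobm j)%VS.
Proof.
apply/prodvP => u v /memv_capP[Du mu] /memv_capP[Dv mv].
by rewrite memv_cap (memvM (A := frobA j)) // aug_mul.
Qed.

Lemma frob_aug j f : f \in frobv j -> f - (eps f)%:A \in frobm j.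
Proof. by move=> Df; rewrite memv_cap aug_sub (@rpredB A) // rpredZ // frob1. Qed.

Lemma frob_decomp j : (frobA j <= 1 + frobm j)%VS.
Proof.
apply/subvP => f Df; rewrite -[f](subrK (eps f)%:A) addrC memv_add //.
  by rewrite rpredZ ?memv_line.
exact: frob_aug.
Qed.

Lemma frobvSS j : (frobv j.+1 <= frobv j)%VS.
Proof.
by apply/subvP => _ /frobS[g Dg ->]; apply: (mem_exp (D := frobA j)); rewrite ?frob1.
Qed.

Variable N : nat.
Hypothesis m_nil : (m ^+ N = 0)%VS.

(** 1 - f is nilpotent, so a finite geometric series inverts f. *)
Lemma unit_eps f : eps f = 1 -> f \is a GRing.unit.
Proof.
move=> f1; have: 1 - f \in m by rewrite mem_aug rmorphB rmorph1 /= f1 subrr.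
move=> mf; have nil : (1 - f) ^+ N = 0.
  apply/eqP; rewrite -memv0 -m_nil; elim: N => [|n IHn]; first exact: memv_line.
  by rewrite exprS expvSl memv_mul.
apply/unitrPr; exists (\sum_(i < N) (1 - f) ^+ i).
have := subrX1 (1 - f) N; rewrite nil sub0r addrAC subrr sub0r mulNr.
by move/oppr_inj.
Qed.

(** The last clause controls powers of m: for M = 1 it sends m^(p^j+1) into m_j^2, and the general
    case is what passes to the next level. *)
Definition retraction j (Pi : 'End(A)) := [/\ forall f, Pi f \in frobv j,
  forall f g, f \in frobv j -> Pi (f * g) = f * Pi g, Pi 1 = 1 &
  forall M n f, (p ^ j * M < n)%N -> f \in (m ^+ n)%VS -> Pi f \in (frobm j ^+ M.+1)%VS].

Lemma aug_prod : (m * m <= m)%VS.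
Proof. by apply/prodvP => u v mu mv; apply: aug_mul. Qed.

Lemma frobm_nil j : (frobm j ^+ N = 0)%VS.
Proof.
by apply/eqP; rewrite -subv0 -m_nil; apply: expvS; apply: capvSr.
Qed.

Lemma retraction0 : retraction 0 \1%VF.
Proof.
have D0 f : f \in frobv 0 by apply/frobvP; exists f.
split=> [f|f g _||M n f]; rewrite ?id_lfunE // expn0 mul1n => Mn.
have -> : frobm 0 = m.
  by apply/vspaceP => g; rewrite memv_cap D0.
by apply/subvP; apply: expv_antimono; rewrite ?aug_prod.
Qed.

(** The contribution of one level. The kernel and descent criteria are restated with translations by
    the h_i, which make sense in H, in place of the auxiliary derivations E_i. *)
Lemma level j Pi : retraction j Pi -> exists r (h : 'I_r -> 'rV[K]_d),
  [/\ forall i, pair (1 : A) (h i) = 0 /\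
        forall f, f \in (m ^+ (p ^ j).+1)%VS -> pair f (h i) = 0,
      exists Pi', retraction j.+1 Pi',
      forall f, f \in frobv j -> (forall i, rt (h i) f = 0) -> f \in frobv j.+1 &
      forall J I : A -> Prop, J 0 ->
        (forall f g, J f -> J g -> J (f + g)) ->
        (forall f g, J f -> J (g * f)) ->
        (forall i f, J f -> J (rt (h i) f)) ->
        (forall f g, I f -> I g -> I (f + g)) ->
        (forall f g, I f -> I (g * f)) ->
        (forall f, f \in frobv j.+1 -> J f -> I f) ->
        forall f, f \in frobv j -> J f -> I f].
Proof.
move=> [PiD PiM Pi1 Pim].
set D := frobA j; set mj := frobm j; set W := (mj ^+ 2)%VS.
(* U is a complement of m_j^2 in m_j, so its basis represents a basis of m_j modulo m_j^2. *)
set U := (mj :\: W)%VS; set X := vbasis U; set r := \dim U.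
pose x (i : 'I_r) := tnth X i.
have XE : [seq x i | i <- enum 'I_r] = X by apply: map_tnth_enum.
have spX : <<X>>%VS = U by apply: span_basis; apply: vbasisP.
have sWm : (W <= mj)%VS by rewrite /W expv2 frobm_mul.
have Um : (U <= mj)%VS by apply: diffvSl.
have xU i : x i \in U by apply: vbasis_mem; apply: mem_tnth.
have mx i : x i \in mj by apply: (subvP Um).
have m_gen : (mj <= <<[seq x i | i <- enum 'I_r]>> + mj ^+ 2)%VS.
  by rewrite XE spX -{1}(addv_diff_cap mj W) addvS // capvSr.
have mjD : (mj <= D)%VS by apply: capvSl.
have epsm f : f \in mj -> eps f = 0.
  by rewrite memv_cap mem_aug => /andP[_ /eqP].
have PiId f : f \in D -> Pi f = f.
  by move=> Df; rewrite -[f in LHS]mulr1 PiM // Pi1 mulr1.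
(* The functional retracts to D_j, projects onto U along m_j^2 and takes the i-th coordinate. *)
have [h0 h0P] : exists h0 : 'I_r -> 'rV[K]_d, forall i f,
    pair f (h0 i) = coord X i (addv_pi1 mj W (Pi f)).
  apply: (fin_all_exists (P := fun i h => forall f,
    pair f h = coord X i (addv_pi1 mj W (Pi f)))) => i.
  exact: (functional_repr (coord X i \o (addv_pi1 mj W \o Pi)%FUN)).
(* The correction makes h_i vanish on constants and changes nothing on m_j. *)
pose h i := h0 i - pair (1 : A) (h0 i) *: hunit H.
have hE i f : pair f (h i) = pair f (h0 i) - pair (1 : A) (h0 i) * eps f.
  by rewrite pairC pairBl pairZl !(pairC _ f).
have h1 i : pair (1 : A) (h i) = 0.
  by rewrite hE (rmorph1 eps) mulr1 subrr.
have hm i f : f \in mj -> pair f (h i) = pair f (h0 i).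
  by move=> mf; rewrite hE epsm // mulr0 subr0.
have hW i f : f \in W -> pair f (h i) = 0.
  move=> Wf; have mf := subvP sWm _ Wf.
  rewrite hm // h0P PiId ?(subvP mjD) //.
  suff -> : addv_pi1 mj W f = 0 by rewrite linear0.
  have /addv_pi1_pi2 : f \in (mj + W)%VS by apply: (subvP (addvSl _ _)).
  by rewrite addv_pi2_id // => /(canRL (addrK _)); rewrite subrr.
have hx i l : pair (x l) (h i) = (l == i)%:R.
  rewrite hm // h0P PiId ?(subvP mjD) //.
  rewrite daddv_pi_id ?capv_diff //.
  by rewrite /x (tnth_nth 0) coord_free // (basis_free (vbasisP U)).
(* After splitting off constants, the product of the two remaining parts lies in m_j^2, where h_i
   vanishes. *)
have hder i f g : f \in frobv j -> g \in frobv j ->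
    pair (f * g) (h i) = pair f (h i) * eps g + eps f * pair g (h i).
  move=> Df Dg; have mf := frob_aug Df; have mg := frob_aug Dg.
  set f0 := f - _ in mf; set g0 := g - _ in mg.
  have fE : f = f0 + (eps f)%:A by rewrite subrK.
  have gE : g = g0 + (eps g)%:A by rewrite subrK.
  clearbody f0 g0.
  have hf0 : pair f (h i) = pair f0 (h i).
    by rewrite [in LHS]fE pairDl pairZl h1 mulr0 addr0.
  have hg0 : pair g (h i) = pair g0 (h i).
    by rewrite [in LHS]gE pairDl pairZl h1 mulr0 addr0.
  have h00 : pair (f0 * g0) (h i) = 0 by rewrite hW // /W expv2 memv_mul.
  rewrite hf0 hg0 [in LHS]fE [in LHS]gE mulrDl !mulrDr.
  rewrite -!scalerAl -!scalerAr mulr1 !mul1r.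
  by rewrite !pairDl !pairZl h00 h1 !mulr0 add0r addr0 mulrC addrC.
(* The Jacobian matrix of the translations. The augmentation maps it to the identity, so its
   determinant is a unit. *)
pose G : 'M[A]_r := \matrix_(k, l) rt (h k) (x l).
have DG k l : G k l \in D by rewrite mxE rtrans_frob // (subvP mjD).
have Gunit : G \in unitmx.
  rewrite unitmxE unit_eps // -det_map_mx.
  rewrite (_ : map_mx _ _ = 1%:M) ?det1 //.
  by apply/matrixP => k l; rewrite !mxE /= eps_rtrans hx eq_sym.
pose E i : 'End(A) := \sum_k (amull (invmx G i k) \o linfun (rt (h k)))%VF.
have EE i f : E i f = \sum_k invmx G i k * rt (h k) f.
  by rewrite sum_lfunE; apply: eq_bigr => k _; rewrite comp_lfunE !lfunE.
have Ex i l : E i (x l) = (i == l)%:R.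
  have /matrixP/(_ i l) := mulVmx Gunit; rewrite !mxE => <-.
  by rewrite EE; apply: eq_bigr => k _; rewrite !mxE.
have ED i f : f \in D -> E i f \in D.
  move=> Df; rewrite EE; apply: rpred_sum => k _.
  by rewrite memvM ?rtrans_frob // aspace_invmx ?frob1.
have EM i f g : f \in D -> g \in D -> E i (f * g) = E i f * g + f * E i g.
  move=> Df Dg; rewrite !EE mulr_suml mulr_sumr -big_split; apply: eq_bigr => k _ /=.
  by rewrite (rtrans_deriv (hder k)) //; ring.
have D'P f : f \in frobv j.+1 <-> exists2 g, g \in D & f = g ^+ p by apply: frobS.
have m'x i : x i ^+ p \in frobm j.+1.
  rewrite memv_cap mem_aug rmorphXn /= epsm // expr0n.
  rewrite (gtn_eqF (prime_gt0 (pcharf_prime pK))) eqxx andbT.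
  by apply/D'P; exists (x i); rewrite ?(subvP mjD).
have D1 : 1 \in D := frob1 j.
have Dm : (D <= 1 + mj)%VS := frob_decomp j.
have mj_nil : (mj ^+ N = 0)%VS := frobm_nil j.
exists r, h; split.
- move=> i; split=> [|f mf]; first exact: h1.
  (* The case M = 1 of the last clause of [retraction]. *)
  have Pf : Pi f \in W by apply: Pim mf; rewrite muln1.
  have mPf := subvP sWm _ Pf.
  have ef : eps f = 0.
    apply/eqP; rewrite -mem_aug -[m]expv1.
    exact: (subvP (expv_antimono aug_prod _)) mf.
  by rewrite hE ef mulr0 subr0 h0P -(PiId _ (PiD f)) -h0P -hm // hW.
- exists (pretract p x E \o Pi)%VF; split=> [f|f g D'f||M n f Mn mf].
  + rewrite comp_lfunE.
    exact: (pretract_mem pK D1 mjD Dm mj_nil mx m_gen D'P EM Ex (PiD f)).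
  + rewrite !comp_lfunE PiM; last exact: (subvP (frobvSS j)).
    exact: (pretractZp pK D1 mjD mx D'P ED EM D'f (PiD g)).
  + by rewrite comp_lfunE Pi1 (pretract1 pK D1 mjD mx EM Ex).
  + rewrite comp_lfunE.
    (* Level j is used with p M in place of M, since p^j (p M) = p^(j+1) M. *)
    apply: (pretract_expv pK D1 mjD mj_nil mx m_gen (frobm_mul _) m'x EM Ex (ltnSn _)).
    by apply: Pim mf; rewrite mulnA -expnSr.
- move=> f Df Rf.
  apply: (deriv_ker pK D1 mjD Dm mj_nil mx m_gen D'P EM Ex) => // i.
  by rewrite EE big1 // => k _; rewrite Rf mulr0.
- move=> J I J0 JD JM JR ID IM JI.
  apply: (stable_ideal_descent pK D1 mjD Dm mj_nil mx m_gen D'P ED EM Ex) => //.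
  + by move=> g g' Jg Jg'; rewrite -mulN1r; apply: JD => //; apply: JM.
  + move=> i g Jg; rewrite EE; apply: (big_ind J) => // k _; apply: JM.
    exact: JR.
Qed.

End Levels.

(** * Coradical filtration and locality *)

Section Subspaces.
Variables (K : fieldType) (d : nat).
Implicit Types (U V W : 'M[K]_d) (f g x y : 'rV[K]_d).

Lemma mulmx_entry m n q (M : 'M[K]_(m, n)) (N : 'M_(n, q)) i j :
  (row i M *m col j N) 0 0 = (M *m N) i j.
Proof. by rewrite !mxE; apply: eq_bigr => k _; rewrite !mxE. Qed.

Lemma mulmx_col m n q (M : 'M[K]_(m, n)) (N : 'M_(n, q)) j :
  M *m col j N = col j (M *m N).
Proof. by rewrite !colE mulmxA. Qed.

Lemma pair_mx f x : (x *m f^T) 0 0 = pair f x.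
Proof. by rewrite mxE; apply: eq_bigr => i _; rewrite mxE mulrC. Qed.

Definition perp U f := forall u, (u <= U)%MS -> pair f u = 0.

Lemma perpP U f : perp U f <-> U *m f^T = 0.
Proof.
split=> [Uf|Uf u /submxP[w ->]]; last by rewrite -pair_mx -mulmxA Uf mulmx0 mxE.
apply/row_matrixP => i; rewrite row_mul row0; apply/rowP => j.
by rewrite (ord1 j) pair_mx mxE Uf ?row_sub.
Qed.

Lemma perp_sub U x : (forall f, perp U f -> pair f x = 0) -> (x <= U)%MS.
Proof.
move=> Ux; rewrite submxE; apply/eqP/rowP => j; rewrite [RHS]mxE.
have := Ux (col j (cokermx U))^T; rewrite -pair_mx trmxK mulmx_col mxE; apply.
by apply/perpP; rewrite trmxK mulmx_col mulmx_coker; apply/colP => i; rewrite !mxE.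
Qed.

Lemma sub_tensS U V (Z : 'M[K]_d) : (mxvec (U^T *m Z *m V) <= tensS U V)%MS.
Proof.
have -> : U^T *m Z *m V = \sum_a \sum_b Z a b *: tens (row a U) (row b V).
  apply/matrixP => i j; rewrite mxE summxE.
  under eq_bigr => b _ do rewrite mxE mulr_suml.
  rewrite exchange_big; apply: eq_bigr => a _; rewrite summxE.
  apply: eq_bigr => b _; rewrite !mxE big_ord1 !mxE.
  by rewrite mulrAC mulrC mulrA.
rewrite linear_sum; apply: summx_sub => a _; rewrite linear_sum.
apply: summx_sub => b _; rewrite linearZ scalemx_sub //.
by apply: (sumsmx_sup a) => //; apply: (sumsmx_sup b) => //; rewrite genmxE.
Qed.

(** For a symmetric tensor, control of one tensor factor controls both. *)
Lemma sub_tensS_sym U (M : 'M[K]_d) : (M <= U)%MS -> M^T = M ->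
  (mxvec M <= tensS U U)%MS.
Proof.
move=> MU MT; move: (pinvmx U) (mulmxKpV MU) => P M1.
have M2 : U^T *m P^T *m M = M.
  by rewrite -[X in _ *m X]MT -!trmx_mul mulmxA M1.
have -> : M = U^T *m (P^T *m M *m P) *m U.
  by rewrite !mulmxA M2 M1.
exact: sub_tensS.
Qed.

(** The annihilator of H (x) V + U (x) H is the tensor product of the annihilators of U and V; this
    dualises the coradical filtration to products of ideals. *)
Lemma tensS_sum_perp U V (M : 'M[K]_d) :
  (mxvec M <= tensS 1%:M V + tensS U 1%:M)%MS <->
  (forall f g, perp U f -> perp V g -> (f *m M *m g^T) 0 0 = 0).
Proof.
split=> [MS f g /perpP Uf /perpP Vg|MS].
  rewrite -mxvec_dotmul.
  have tens0 x y : x *m f^T = 0 \/ y *m g^T = 0 ->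
      mxvec (tens x y) *m (mxvec (f^T *m g))^T = 0.
    rewrite mxvec_dotmul.
    have -> : x *m (f^T *m g) *m y^T = (x *m f^T) *m (y *m g^T)^T.
      by rewrite trmx_mul trmxK !mulmxA.
    by case=> ->; rewrite ?trmx0 ?mul0mx ?mulmx0.
  have S0 : ((tensS 1%:M V + tensS U 1%:M)%MS <= kermx (mxvec (f^T *m g))^T)%MS.
    rewrite addsmx_sub; apply/andP; split; apply/sumsmx_subP => a _;
      apply/sumsmx_subP => b _; rewrite genmxE; apply/sub_kermxP; apply: tens0.
      by right; rewrite -row_mul Vg row0.
    by left; rewrite -row_mul Uf row0.
  have /sub_kermxP := submx_trans MS S0.
  by move/(congr1 trmx); rewrite trmx_mul trmxK trmx0 => ->; rewrite mxE.
have ker0 : (cokermx U)^T *m M *m cokermx V = 0.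
  apply/matrixP => i j; rewrite [RHS]mxE -mulmx_entry row_mul -[col j _]trmxK.
  apply: MS; apply/perpP; rewrite ?trmxK ?mulmx_col ?mulmx_coker.
    by rewrite -tr_col trmxK mulmx_col mulmx_coker; apply/colP => k; rewrite !mxE.
  by apply/colP => k; rewrite !mxE.
(* [M *m E] has its rows in V. As 1 - E factors through the cokernel of V, [ker0] puts the columns
   of the remaining summand in U. *)
set E := proj_mx V V^C%MS.
have VE : V *m E = V by apply: proj_mx_id => //; apply: capmx_compl.
have M1 : (M *m E <= V)%MS by apply: proj_mx_sub.
have : V *m (1%:M - E) = 0 by rewrite mulmxBr VE mulmx1 subrr.
move=> V0; have {V0}[Z EZ] : exists Z, 1%:M - E = cokermx V *m Z.
  suff /submxP[Z /(congr1 trmx) EZ] : ((1%:M - E)^T <= (cokermx V)^T)%MS.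
    by exists Z^T; rewrite -[LHS]trmxK EZ trmx_mul trmxK.
  apply/row_subP => i; apply: perp_sub => f /perpP/(congr1 trmx).
  rewrite trmx_mul !trmxK trmx0 => /eqP; rewrite -submxE => /submxP[w ->].
  by rewrite -pair_mx -row_mul -trmx_mul -mulmxA V0 mulmx0 trmx0 !mxE.
have M2 : ((M *m (1%:M - E))^T <= U)%MS.
  rewrite submxE; apply/eqP; apply: trmx_inj.
  by rewrite trmx_mul trmxK trmx0 EZ (mulmxA M) (mulmxA _ _ Z) (mulmxA _ M) ker0 mul0mx.
have -> : M = M *m E + M *m (1%:M - E) by rewrite -mulmxDr addrC subrK mulmx1.
rewrite linearD; apply: addmx_sub_adds.
  case/submxP: M1 => Z1 ->; rewrite -[Z1]mul1mx -{1}[1%:M]trmx1.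
  exact: sub_tensS.
case/submxP: M2 => Z2 /(congr1 trmx); rewrite trmxK => ->.
by rewrite trmx_mul -[U^T *m _]mulmx1; apply: sub_tensS.
Qed.

(** If U is not yet least, intersecting it with some V lowers the rank. This gives meaning to the
    choice in [lsub]. *)
Lemma least_exists (P : 'M[K]_d -> Prop) : P 1%:M ->
  (forall U V, P U -> P V -> P (U :&: V)%MS) -> least P (lsub P).
Proof.
move=> P1 Pcap; rewrite /lsub; apply: epsilon_spec.
have [n] := ubnP (\rank (1%:M : 'M[K]_d)); move: P1; move: 1%:M.
elim: n => // n IHn U PU rU.
case: (classic (forall V, P V -> (U <= V)%MS)) => [|/not_all_ex_not[V nUV]].
  by exists U.
have [PV /negP UV] := imply_to_and _ _ nUV.
apply: (IHn (U :&: V)%MS); first exact: Pcap.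
move: rU; rewrite ltnS; apply: leq_trans; rewrite ltn_neqAle mxrankS ?capmxSl // andbT.
apply: contra UV => /eqP rUV; apply: submx_trans (capmxSr U V).
by rewrite -(mxrank_leqif_sup (capmxSl U V)) rUV.
Qed.

End Subspaces.

(** * Nilpotency in finite-dimensional commutative algebras *)

Section Nilpotence.
Variables (K : fieldType) (d : nat) (c : struct_const K d).
Local Notation A := (scalg c).
Implicit Types (f g : A) (U V : {vspace A}).

Lemma sc_prodvC U V : (U * V = V * U)%VS.
Proof.
by apply/subv_anti/andP; split; apply/prodvP => u v Uu Vv;
  rewrite mulrC memv_mul.
Qed.

(** Among a + b factors, at least a come from U or at least b from V; [fullv] absorbs the others. *)
Lemma expv_add_sub U V a b :
  ((U + V) ^+ (a + b) <= U ^+ a * fullv + V ^+ b * fullv)%VS.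
Proof.
have trivX (W W' : {vspace A}) : (W' <= W ^+ 0 * fullv)%VS by rewrite expv0 prod1v subvf.
elim: a b => [|a IHa] b.
  exact: subv_trans (trivX U _) (addvSl _ _).
elim: b => [|b IHb].
  exact: subv_trans (trivX V _) (addvSr _ _).
have absorb (W W' : {vspace A}) n : (W * (W' ^+ n * fullv) <= W' ^+ n * fullv)%VS.
  by rewrite prodvA (sc_prodvC W) -prodvA prodvSr // subvf.
have shift (W : {vspace A}) n : (W * (W ^+ n * fullv) <= W ^+ n.+1 * fullv)%VS.
  by rewrite expvSl -prodvA.
rewrite addSn expvSl prodvDl subv_add; apply/andP; split.
  apply: subv_trans (prodvSr U (IHa b.+1)) _.
  by rewrite prodvDr addvS.
rewrite -addSnnS; apply: subv_trans (prodvSr V IHb) _.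
by rewrite prodvDr addvS.
Qed.

Lemma span_nilpotent (s : seq A) : (forall f, f \in s -> exists n, f ^+ n = 0) ->
  exists n, (<<s>> ^+ n = 0)%VS.
Proof.
elim: s => [|f s IHs] nil; first by exists 1%N; rewrite span_nil.
have [a fa] := nil f (mem_head _ _).
have [b sb] : exists n, (<<s>> ^+ n = 0)%VS.
  by apply: IHs => g gs; apply: nil; rewrite inE gs orbT.
exists (a + b)%N; rewrite span_cons; apply/eqP; rewrite -subv0.
apply: subv_trans (expv_add_sub _ _ _ _) _.
have -> : (<[f]> ^+ a = 0)%VS.
  by rewrite expv_line fa; apply/eqP; rewrite -subv0 -memvE mem0v.
by rewrite sb !prod0v addv0 subvv.
Qed.

(** The descending chain of principal ideals f^n A stabilises by dimension. *)
Lemma fitting f : exists n g, f ^+ n = f ^+ n.+1 * g.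
Proof.
pose I n := limg (amull (f ^+ n)).
have IP n g : f ^+ n * g \in I n.
  by apply/memv_imgP; exists g; rewrite ?memvf // lfunE.
have sI n : (I n.+1 <= I n)%VS.
  by apply/subvP => _ /memv_imgP[g _ ->]; rewrite lfunE /= exprSr -mulrA IP.
suff [n In] : exists n, I n.+1 = I n.
  have := IP n 1; rewrite mulr1 -In => /memv_imgP[g _]; rewrite lfunE /= => fn.
  by exists n, g.
have [t] := ubnP (\dim (I 0%N)); move: 0%N => n.
elim: t n => // t IHt n lt_t.
have [le_n|lt_n] := leqP (\dim (I n)) (\dim (I n.+1)).
  by exists n; apply/eqP; rewrite eqEdim sI.
by apply: (IHt n.+1); apply: leq_trans lt_n _; rewrite -ltnS.
Qed.

(** By [fitting], f^n is killed by some 1 - f g, which is a unit. *)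
Lemma nilpotent_of_local f :
  (forall g, 1 - f * g \is a GRing.unit) -> exists n, f ^+ n = 0.
Proof.
move=> Uf; have [n [g fn]] := fitting f; exists n.
by apply: (mulIr (Uf g)); rewrite mul0r mulrBr mulr1 mulrA -exprSr -fn subrr.
Qed.

End Nilpotence.

(** * Subcoalgebras, connectedness and locality of the dual *)

Section Coalgebra.
Variables (K : fieldType) (d : nat) (H : hopf_data K d).
Hypotheses (hopfH : is_hopf H) (cocH : cocommutative H).
Local Notation A := (scalg (dual_sc hopfH cocH)).
Local Notation m := (aug hopfH cocH).
Local Notation eps := (@dual_eps _ _ _ hopfH cocH).
Implicit Types (f g : A) (x y h : 'rV[K]_d) (I : {vspace A}).

Definition annmx I : 'M[K]_d :=
  kermx (\matrix_(k < d, i < \dim I) (tnth (vbasis I) i : A) 0 k).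

Lemma annmxP I x : reflect (forall f, f \in I -> pair f x = 0) (x <= annmx I)%MS.
Proof.
apply: (iffP sub_kermxP) => [x0 f If|x0].
  rewrite (coord_vbasis If) pair_suml big1 // => i _.
  rewrite pairZl; have /rowP/(_ i) := x0; rewrite !mxE => xi.
  suff -> : pair (vbasis I)`_i x = 0 by rewrite mulr0.
  by rewrite -[RHS]xi; apply: eq_bigr => k _; rewrite mxE mulrC (tnth_nth 0).
apply/rowP => i; rewrite !mxE.
rewrite -[RHS](x0 _ (vbasis_mem (mem_tnth i (vbasis I)))).
by apply: eq_bigr => k _; rewrite mxE mulrC.
Qed.

Lemma annmx_eq0 I : annmx I = 0 -> I = fullv.
Proof.
move=> /eqP; rewrite -mxrank_eq0 mxrank_ker subn_eq0 => dI.
apply/eqP; rewrite eqEdim subvf dimvf /=.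
by rewrite [X in (X <= _)%N]mul1n; exact: leq_trans dI (rank_leq_col _).
Qed.

(** The action of H^* on H sending x to sum x_1 f(x_2), transpose to multiplication by f. *)
Definition coact f x : 'rV[K]_d := \row_k pair ((evec K k : A) * f) x.

Lemma pair_coact f g x : pair g (coact f x) = pair (g * f) x.
Proof.
have gE : g = \sum_k g 0 k *: (evec K k : A) := evec_decomp g.
rewrite [in RHS]gE mulr_suml pair_suml.
apply: eq_bigr => k _.
by rewrite -scalerAl pairZl mxE.
Qed.

Lemma hunit_neq0 : hunit H != 0.
Proof.
apply/eqP => u0; have : pair (1 : A) (hunit H) = 1 := rmorph1 eps.
by rewrite u0 pair0r => /eqP; rewrite eq_sym oner_eq0.
Qed.

Lemma mx_comul_pair f g x : (f *m comulH H x *m g^T) 0 0 = pair (f * g) x.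
Proof.
rewrite pairM mxE; under eq_bigr => j _ do rewrite !mxE mulr_suml.
rewrite exchange_big; apply: eq_bigr => i _; apply: eq_bigr => j _ /=.
by ring.
Qed.

(** Row i of the coproduct of x pairs with f as e_i f pairs with x, so the rows annihilate the
    ideal; cocommutativity handles the columns. *)
Lemma subcoalg_annmx I : (forall f g, f \in I -> g * f \in I) -> subcoalg H (annmx I).
Proof.
move=> Iid x /annmxP xI; apply: sub_tensS_sym; last by rewrite -cocH.
apply/row_subP => i; apply/annmxP => f If.
have := xI _ (Iid f (evec K i) If); rewrite -mx_comul_pair -pair_mx.
by rewrite rowE.
Qed.

Lemma subcoalg_unit : subcoalg H <<hunit H>>%MS.
Proof.
have [_ _ _ _ [[_ cu] _]] := hopfH.
move=> x; rewrite genmxE => /sub_rVP[a ->].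
have -> : comulH H (a *: hunit H) = a *: comulH H (hunit H).
  by rewrite scaler_sumr; apply: eq_bigr => i _; rewrite mxE scalerA.
apply: sub_tensS_sym; rewrite cu; last by rewrite linearZ /= trmx_mul trmxK.
by rewrite genmxE scalemx_sub // mulmx_sub.
Qed.

Lemma simple_unit : simple_subcoalg H <<hunit H>>%MS.
Proof.
have r1 : \rank <<hunit H>>%MS = 1%N by rewrite genmxE rank_rV hunit_neq0.
split; [exact: subcoalg_unit | by rewrite -mxrank_eq0 r1 |].
move=> C _ sC; case: (eqVneq C 0) => [|nz]; [by left | right].
by rewrite -(mxrank_leqif_sup sC) r1 eqn_leq lt0n mxrank_eq0 nz -[X in (_ <= X)%N]r1 mxrankS.
Qed.

Lemma coradicalP :
  (forall C, simple_subcoalg H C -> (C <= coradical H)%MS) /\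
  forall W : 'M[K]_d, (forall C, simple_subcoalg H C -> (C <= W)%MS) -> (coradical H <= W)%MS.
Proof.
apply: least_exists => [C _|U V PU PV C sC]; first exact: submx1.
by rewrite sub_capmx PU // PV.
Qed.

Hypothesis connH : connected H.

Lemma coradical_unit : (coradical H :=: hunit H)%MS.
Proof.
have sub : (hunit H <= coradical H)%MS.
  by have := coradicalP.1 _ simple_unit; rewrite genmxE.
apply/eqmxP; rewrite sub andbT -(mxrank_leqif_sup sub).
by rewrite rank_rV hunit_neq0 connH.
Qed.

(** By induction on rank, C contains a simple subcoalgebra, which must be the coradical, spanned by
    the unit. *)
Lemma subcoalg_has_unit C : subcoalg H C -> C != 0 -> (hunit H <= C)%MS.
Proof.
have [n] := ubnP (\rank C); elim: n C => // n IHn C rC sC nzC.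
case: (classic (simple_subcoalg H C)) => [simC|nsim].
  have CH : (C <= hunit H)%MS by rewrite -coradical_unit; apply: coradicalP.1.
  by rewrite -(mxrank_leqif_sup CH) rank_rV hunit_neq0 eqn_leq lt0n mxrank_eq0 nzC
    (leq_trans (mxrankS CH)) ?rank_leq_row.
apply: NNPP => no; apply: nsim; split=> // C' sC' CC'.
have [->|nzC'] := eqVneq C' 0; [by left | right].
apply/negPn/negP => nCC'; apply: no; apply: submx_trans (CC').
apply: IHn => //; move: rC; rewrite ltnS; apply: leq_trans.
by rewrite ltn_neqAle mxrankS // andbT (mxrank_leqif_sup CC').
Qed.

(** The annihilator of the ideal (1 - f)A is a subcoalgebra without the unit, since 1 - f has
    augmentation 1. Hence it is zero and the ideal is all of A. *)
Lemma local_unit f : f \in m -> 1 - f \is a GRing.unit.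
Proof.
move=> mf; set I := limg (amull (1 - f)).
have IP g : (1 - f) * g \in I.
  by apply/memv_imgP; exists g; rewrite ?memvf // lfunE.
have annI : annmx I = 0.
  apply/eqP/negPn/negP => nz.
  have /annmxP/(_ _ (IP 1)) : (hunit H <= annmx I)%MS.
    apply: subcoalg_has_unit nz; apply: subcoalg_annmx => _ g /memv_imgP[u _ ->].
    by rewrite lfunE /= mulrCA IP.
  rewrite mulr1; change (pair (1 - f) (hunit H)) with (eps (1 - f)).
  move: mf; rewrite rmorphB rmorph1 mem_aug /= => /eqP->.
  by rewrite subr0 => /eqP; rewrite oner_eq0.
have := memvf (1 : A); rewrite -(annmx_eq0 annI) => /memv_imgP[g _].
by rewrite lfunE /= => e; apply/unitrPr; exists g.
Qed.

Lemma aug_nilpotent : exists N, (m ^+ N = 0)%VS.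
Proof.
rewrite -(span_basis (vbasisP m)); apply: span_nilpotent => f /vbasis_mem mf.
by apply: nilpotent_of_local => g; apply: local_unit; rewrite mulrC aug_mul.
Qed.

Lemma preimCP (W : 'M[K]_(d * d)) x :
  (x <= preimC H W)%MS = (mxvec (comulH H x) <= W)%MS.
Proof.
rewrite (sameP sub_kermxP eqP) mulmxA -submxE; congr (_ <= _)%MS.
apply/rowP => j; case/mxvec_indexP: j => i j.
rewrite mxvecE comulHE mxE; apply: eq_bigr => k _.
by rewrite mxE mxvecE.
Qed.

Lemma perp_coradical f : perp (coradical H) f <-> f \in m.
Proof.
rewrite mem_aug; split=> [Cf|/eqP f0 u].
  by apply/eqP/Cf; rewrite coradical_unit.
by rewrite coradical_unit => /sub_rVP[a ->]; rewrite pairZr [pair _ _]f0 mulr0.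
Qed.

(** Taking preimages under the coproduct is dual to multiplying ideals, and the annihilator of the
    coradical is m, so each step adds a factor m. *)
Lemma corad_filtP n x :
  reflect (forall f, f \in (m ^+ n.+1)%VS -> pair f x = 0) (x <= corad_filt H n)%MS.
Proof.
apply: (iffP idP); elim: n x => [|n IHn] x.
- by move=> Cx f /perp_coradical; apply.
- rewrite preimCP => /tensS_sum_perp xW; rewrite expvSl.
  apply: prodv_ind => [|u v mu mv].
    by split=> [|a u v u0 v0]; rewrite ?pair0l // pairDl pairZl u0 v0 mulr0 addr0.
  rewrite -mx_comul_pair; apply: xW; first exact/perp_coradical.
  by move=> y /IHn; apply.
- by move=> x0; apply: perp_sub => f /perp_coradical; apply: x0.
move=> x0; rewrite preimCP; apply/tensS_sum_perp => f g /perp_coradical mf Cg.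
(* The functional g is only known to vanish on H_n, so it suffices that [coact f x] lies in H_n. *)
rewrite [LHS]mx_comul_pair mulrC -pair_coact; apply: Cg; apply: IHn => u mu.
by rewrite pair_coact; apply: x0; rewrite expvSr memv_mul.
Qed.

End Coalgebra.

(** * The correspondence *)

Section Correspondence.
Variables (K : closedFieldType) (p d : nat) (H : hopf_data K d).
Hypotheses (pK : p \in [pchar K]) (hopfH : is_hopf H) (cocH : cocommutative H).
Hypothesis connH : connected H.
Local Notation A := (scalg (dual_sc hopfH cocH)).
Local Notation m := (aug hopfH cocH).
Local Notation eps := (@dual_eps _ _ _ hopfH cocH).
Local Notation rt := (@rtransA _ _ _ hopfH cocH).
Local Notation frob := (frobv p hopfH cocH).
Implicit Types (f g : A) (x y h : 'rV[K]_d).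

Lemma aug_expv_mul n f g : f \in (m ^+ n.+1)%VS -> g * f \in (m ^+ n.+1)%VS.
Proof.
rewrite expvSl; move: f; apply: (@prodv_ind _ _ _ _ (fun f => g * f \in _)).
  by split=> [|a u v gu gv]; rewrite ?mulr0 ?mem0v // mulrDr -scalerAr rpredD ?rpredZ.
by move=> u v mu mv; rewrite mulrA memv_mul // aug_mul.
Qed.

Lemma gen_subalgP (V : 'M[K]_d) :
  least (fun B => subalgebra H B /\ (V <= B)%MS) (gen_subalg H V).
Proof.
apply: least_exists => [|B C [[B1 BM] VB] [[C1 CM] VC]].
  by split; [split=> [|x y _ _] |]; rewrite submx1.
split; last by rewrite sub_capmx VB.
split=> [|x y]; first by rewrite sub_capmx B1.
rewrite !sub_capmx => /andP[xB xC] /andP[yB yC].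
by rewrite BM // CM.
Qed.

Lemma subalgebra_unit : subalgebra H <<hunit H>>%MS.
Proof.
have [_ u1 _ _ _] := hopfH.
split=> [|x y]; first by rewrite genmxE.
rewrite !genmxE => /sub_rVP[a ->] yH.
by rewrite mulHZl (u1 y).1 scalemx_sub.
Qed.

Lemma gamma_subalgebra n : subalgebra H (Gamma_up H p n).
Proof.
case: n => [|n]; first exact: subalgebra_unit.
by have [[]] := gen_subalgP (corad_filt H (p ^ n)).
Qed.

Lemma corad_filt_gamma n : (corad_filt H (p ^ n) <= Gamma_up H p n.+1)%MS.
Proof. by have [[]] := gen_subalgP (corad_filt H (p ^ n)). Qed.

Lemma coact_mulH f s x y : coprod H f s ->
  coact f (mulH H x y) =
  \sum_(t <- s) mulH H (coact (t.1 : A) x) (coact (t.2 : A) y).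
Proof.
move=> fs; apply: pair_extr => g; rewrite pair_coact pair_sumr.
have gt := coprod_ltrans H g; rewrite (coprodM gt fs) big_allpairs_dep exchange_big.
apply: eq_bigr => u _; rewrite gt; apply: eq_bigr => v _.
by rewrite !pair_coact.
Qed.

(** Gamma^n(H) is a subcoalgebra: the elements whose orbit under H^* stays in it form a subalgebra,
    which contains the generators because these annihilate an ideal. *)
Lemma gamma_coact n f x : (x <= Gamma_up H p n)%MS ->
  (coact f x <= Gamma_up H p n)%MS.
Proof.
move=> Gx; have [C1 CM] := gamma_subalgebra n.
set C := Gamma_up H p n in C1 CM Gx *.
have stable1 g : (coact g (hunit H) <= C)%MS.
  suff -> : coact g (hunit H) = eps g *: hunit H by rewrite scalemx_sub.
  apply: pair_extr => u; rewrite pair_coact pairZr mulrC.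
  exact: (rmorphM eps).
case: n @C C1 CM Gx stable1 => [|n] C C1 CM Gx stable1.
  move: Gx; rewrite genmxE => /sub_rVP[a ->].
  have -> : coact f (a *: hunit H) = a *: coact f (hunit H).
    by apply: pair_extr => u; rewrite pairZr !pair_coact pairZr.
  by rewrite scalemx_sub.
have [[_ VC] Cmin] := gen_subalgP (corad_filt H (p ^ n)).
pose J : {vspace A} := (\bigcap_(i < d) annv hopfH cocH (row i C))%VS.
have JP g : g \in J <-> perp C g.
  split=> [Jg u /submxP[w ->]|Cg].
    rewrite mulmx_sum_row pair_sumr big1 // => i _; rewrite pairZr.
    by move: Jg; rewrite memvE => /subv_bigcapP/(_ i isT); rewrite -memvE mem_annv
      => /eqP->; rewrite mulr0.
  rewrite memvE; apply/subv_bigcapP => i _; rewrite -memvE mem_annv Cg //.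
  exact: row_sub.
(* The subalgebra of elements with orbit in C, obtained as annihilator of the ideal generated by
   [J], the annihilator of C. *)
set C' := annmx (fullv * J)%VS.
have C'P y : (y <= C')%MS <-> forall g, (coact g y <= C)%MS.
  split=> [/annmxP yC' g|yC]; first apply: perp_sub => u /JP Ju.
    by rewrite pair_coact mulrC yC' // memv_mul ?memvf.
  apply/annmxP; apply: prodv_ind => [|g u _ Ju].
    by split=> [|a u v u0 v0]; rewrite ?pair0l // pairDl pairZl u0 v0 mulr0 addr0.
  by rewrite mulrC -pair_coact; apply: (iffLR (JP u)).
apply: (iffLR (C'P x)); apply: submx_trans Gx _; apply: Cmin; split; first split.
- exact/C'P.
- move=> y z /C'P yC /C'P zC; apply/C'P => g.
  rewrite (coact_mulH _ _ (coprod_ltrans H g)).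
  by apply: summx_sub => t _; apply: CM.
apply/rV_subP => y Vy; apply/C'P => g; apply: submx_trans VC.
apply/(corad_filtP hopfH cocH connH) => u mu; rewrite pair_coact.
apply: (elimT (corad_filtP hopfH cocH connH _ _) Vy).
by rewrite mulrC aug_expv_mul.
Qed.

Lemma aug_pow f n : (0 < n)%N -> eps (f ^+ n) = 0 -> f \in m.
Proof.
move=> n0 /eqP; rewrite rmorphXn expf_eq0 n0 /= => f0.
by rewrite mem_aug.
Qed.

Definition coann n x := forall f g, g \in frob n -> eps g = 0 -> pair (f * g) x = 0.

Lemma coannE n x f g : coann n x -> g \in frob n -> pair (f * g) x = eps g * pair f x.
Proof.
move=> Bx Dg; have g0 := frob_aug pK Dg.
rewrite -[g in LHS](subrK (eps g)%:A) mulrDr pairDl -scalerAr mulr1 pairZl.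
rewrite Bx ?add0r //; first by move: g0; rewrite memv_cap => /andP[].
by move: g0; rewrite memv_cap mem_aug => /andP[_ /eqP].
Qed.

Lemma coannP n x : reflect (coann n x) (x <= annmx (fullv * frobm p hopfH cocH n)%VS)%MS.
Proof.
apply: (iffP (annmxP _ _)) => [x0 f g Dg g0|x0].
  by apply: x0; rewrite memv_mul ?memvf // memv_cap Dg mem_aug g0 eqxx.
apply: prodv_ind => [|f g _]; last first.
  by rewrite memv_cap mem_aug => /andP[Dg /eqP]; apply: x0.
by split=> [|a u v u0 v0]; rewrite ?pair0l // pairDl pairZl u0 v0 mulr0 addr0.
Qed.

(** The right-hand side is a subalgebra because D_n is closed under the comultiplication, and it
    contains the generators by comparison of exponents. *)
Lemma gamma_sub n x : (x <= Gamma_up H p n)%MS -> coann n x.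
Proof.
have coann1 : coann n (hunit H).
  by move=> f g _ g0; rewrite -[LHS]/(eps (f * g)) rmorphM /= g0 mulr0.
case: n coann1 => [|n] coann1.
  rewrite genmxE => /sub_rVP[a ->] f g Dg g0.
  by rewrite pairZr coann1 ?mulr0.
move=> Gx; apply/coannP; apply: submx_trans Gx _.
have [_] := gen_subalgP (corad_filt H (p ^ n)); apply; split; first split.
- exact/coannP.
- move=> y z /coannP By /coannP Bz; apply/coannP => f g Dg g0.
  have [t gt Dt] := frob_coprod pK Dg; have fs := coprod_ltrans H f.
  rewrite (coprodM fs gt) big_allpairs_dep exchange_big big_seq /=.
  (* On y and z the tensor factors of the coproduct of g act through their augmentations, that is,
     their values at the unit. *)
  transitivity (pair f (mulH H y z) * pair g (mulH H (hunit H) (hunit H))).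
    rewrite fs gt mulr_sumr [RHS]big_seq; apply: eq_bigr => u /Dt[D1 D2].
    rewrite mulr_suml; apply: eq_bigr => v _.
    by rewrite (coannE _ By D1) (coannE _ Bz D2) /dual_eps /evalA; ring.
  have [_ u1 _ _ _] := hopfH.
  by rewrite (u1 _).1 [pair g _]g0 mulr0.
apply/rV_subP => y Vy; apply/coannP => f _ /(frobvP pK)[h ->] h0.
have mh : h \in m by apply: aug_pow h0; rewrite expn_gt0 prime_gt0 ?(pcharf_prime pK).
apply: (elimT (corad_filtP hopfH cocH connH _ _) Vy).
apply: aug_expv_mul; have hq k : h ^+ k \in (m ^+ k)%VS.
  elim: k => [|k IHk]; first exact: memv_line.
  by rewrite exprS expvSl memv_mul.
(* Strictness matters: the generators annihilate m^(p^n+1), and the power of [h] lies in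
   m^(p^(n+1)). *)
have q_lt : (p ^ n < p ^ n.+1)%N by rewrite ltn_exp2l ?prime_gt1 ?(pcharf_prime pK).
apply: (subvP (expv_antimono _ _)) (hq _); first exact: aug_prod.
exact: q_lt.
Qed.

Lemma exists_retraction N j : (m ^+ N = 0)%VS ->
  exists Pi : 'End(A), retraction p j Pi.
Proof.
move=> m_nil; elim: j => [|j [Pi PiP]]; first by exists \1%VF; apply: retraction0.
by have [r [h []]] := level pK m_nil PiP.
Qed.

Lemma corad_filt_gamma_leq j n h : (j < n)%N ->
  (forall f, f \in (m ^+ (p ^ j).+1)%VS -> pair f h = 0) -> (h <= Gamma_up H p n)%MS.
Proof.
case: n => // n jn hj; apply: submx_trans (corad_filt_gamma n).
apply/(corad_filtP hopfH cocH connH) => f mf; apply: hj.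
apply: (subvP (expv_antimono _ _)) mf; first exact: aug_prod.
by rewrite ltn0Sn /= ltnS leq_exp2l ?prime_gt1 ?(pcharf_prime pK).
Qed.

(** For the converse, ideal descent is applied at levels n-1, ..., 0 to the annihilator of
    Gamma^n(H). *)
Lemma gammaP n x : (x <= Gamma_up H p n)%MS <-> coann n x.
Proof.
split=> [|Bx]; first exact: gamma_sub.
have [N m_nil] := aug_nilpotent hopfH cocH connH.
have [C1 CM] := gamma_subalgebra n.
apply: perp_sub => f Cf.
pose I (g : A) := forall a, pair (a * g) x = 0.
(* The induction starts in D_n at t = 0 and reaches D_0 = A at t = n. *)
suff If : forall t g, (t <= n)%N -> g \in frob (n - t) -> perp (Gamma_up H p n) g -> I g.
  have := If n f (leqnn n) _ Cf 1; rewrite mul1r; apply.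
  by rewrite subnn; apply/(frobvP pK); exists f.
elim=> [|t IHt] g tn Dg Cg.
  rewrite subn0 in Dg; move=> a; apply: Bx => //.
  (* The augmentation of g is its value at the unit, which belongs to Gamma^n(H). *)
  exact: Cg.
have [Pi PiP] := exists_retraction (n - t.+1) m_nil.
have [r [h [h1 _ _ descent]]] := level pK m_nil PiP.
(* The annihilator is an ideal by [gamma_coact]; it is stable under translation by the h_i because
   these lie in the subalgebra Gamma^n(H). *)
apply: (descent (perp (Gamma_up H p n)) I) Dg Cg.
- by move=> u _; exact: pair0l.
- by move=> u v Cu Cv y Gy; rewrite pairDl Cu ?Cv ?addr0.
- by move=> u v Cu y Gy; rewrite mulrC -pair_coact Cu ?gamma_coact.
- move=> i u Cu y Gy; rewrite pair_rtrans Cu // CM //.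
  by apply: (corad_filt_gamma_leq (j := n - t.+1)) (h1 i).2; rewrite ltn_subrL (leq_trans _ tn).
- by move=> u v Iu Iv a; rewrite mulrDr pairDl Iu Iv addr0.
- by move=> u v Iu a; rewrite mulrA Iu.
move=> u Du Cu; apply: (IHt u (ltnW tn)) => //.
by rewrite (_ : n - t = (n - t.+1).+1)%N //; lia.
Qed.

(** Conversely, for j < n the h_i of level j lie in Gamma^n(H) and have counit 0, so translation by
    them kills g and [level] lifts g from D_j to D_(j+1). *)
Lemma frob_coinvariant n g : g \in frob n <->
  (forall x y, (y <= Gamma_up H p n)%MS -> pair (1 : A) y = 0 -> pair g (mulH H x y) = 0).
Proof.
split=> [Dg x y /gammaP By y0|cg].
  have [s gs Ds] := frob_coprod pK Dg.
  rewrite gs big_seq big1 // => t /Ds[_ D2].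
  by have := coannE 1 By D2; rewrite mul1r => ->; rewrite y0 !mulr0.
have [N m_nil] := aug_nilpotent hopfH cocH connH.
suff frob_le j : (j <= n)%N -> g \in frob j by apply: frob_le.
elim: j => [_|j IHj jn]; first by apply/(frobvP pK); exists g.
have [Pi PiP] := exists_retraction j m_nil.
have [r [h [h1 _ ker _]]] := level pK m_nil PiP.
apply: ker; first exact: IHj (ltnW jn).
move=> i; apply: pair_extl => y; rewrite pair_rtrans pair0l cg //.
  exact: corad_filt_gamma_leq jn (h1 i).2.
exact: (h1 i).1.
Qed.

End Correspondence.

Theorem theorem4p1 (K : closedFieldType) (p d : nat) (H : hopf_data K d) :
  p \in [pchar K] -> is_hopf H -> cocommutative H -> connected H ->
  forall n : nat,
    (* Gamma^n(H) = (H^* / Gamma_n(H^* ))^* = { x | <f g, x> = 0 for f in H^*, g in Gamma_n(H^* )^+ } *)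
    (forall x : 'rV[K]_d,
       (x <= Gamma_up H p n)%MS <->
       (forall f g : 'rV[K]_d, in_Gamma_low H p n g -> counitH (dual_hopf H) g = 0 ->
          pair (mulH (dual_hopf H) f g) x = 0))
    /\
    (* Gamma_n(H^* ) = (H / Gamma^n(H))^* = { g | <g, x y> = 0 for x in H, y in Gamma^n(H)^+ } *)
    (forall g : 'rV[K]_d,
       in_Gamma_low H p n g <->
       (forall x y : 'rV[K]_d, (y <= Gamma_up H p n)%MS -> counitH H y = 0 ->
          pair g (mulH H x y) = 0)).
Proof.
move=> pK hopfH cocH connH n.
have lowP g : in_Gamma_low H p n g <-> g \in frobv p hopfH cocH n.
  rewrite (frobvP pK); split=> -[f ->]; exists f.
    exact: (@dual_powE _ _ _ hopfH cocH).
  by symmetry; exact: (@dual_powE _ _ _ hopfH cocH).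
split=> [x | g].
  rewrite (gammaP pK hopfH cocH connH); split=> Bx f g.
    by move=> /lowP Dg g0; rewrite (@dual_mulE _ _ _ hopfH cocH); apply: Bx.
  by move=> Dg g0; rewrite -dual_mulE; apply: Bx => //; apply/lowP.
rewrite lowP (frob_coinvariant pK connH); split=> cg x y Gy y0; apply: cg => //.
  by rewrite pair1.
by rewrite -(pair1 hopfH cocH).
Qed.
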